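(* Let $m\ge2$ be an integer. The critical value function $\theta_m$ has $\psi(m)$ discontinuity points, namely $\mathbf b_{m,k_1,\ldots,k_j}$ with $(m,k_1,\ldots,k_j)\in\mathcal A_m$, and for $(m,k_1,\ldots,k_j),(m,k_1',\ldots,k_l')\in\mathcal A_m$, $$\mathbf b_{m,k_1,\ldots,k_j}\prec\mathbf b_{m,k_1',\ldots,k_l'}\iff(m,k_1,\ldots,k_j)\prec(m,k_1',\ldots,k_l').$$ Furthermore, $\theta_m$ is determined as follows. (i) If $\mathbf b\preccurlyeq\mathbf b_{m,1}$, then $\theta_m(\mathbf b)=0^\infty$. (ii) If $\mathbf b\succ\mathbf b_{m,m-1}$, then $\theta_m(\mathbf b)=(\mathbf w_{(m-1)/m})^\infty$. (iii) If $\mathbf b\in\mathbf I_{m,k_1,\ldots,k_j}$ for some other $m$-partition interval $\mathbf I_{m,k_1,\ldots,k_j}$, i.e. for some $(m,k_1,\ldots,k_j)\in\mathcal A_m\setminus\{(m,m-1)\}$, then $$\theta_m(\mathbf b)=(\mathbf w_{k_1/m_1}\bullet\cdots\bullet\mathbf w_{k_j/m_j})^\infty,$$ where $m_1=m$ and $m_i=\gcd(m,k_1,\ldots,k_{i-1})$ for $2\le i\le j$.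
   Context: Critical value. $\{0,1\}^{\mathbb N}$ carries the product topology and the lexicographical order $\prec,\preccurlyeq$; $\sigma$ is the left shift. For $\mathbf a,\mathbf b\in\{0,1\}^{\mathbb N}$ let $\Sigma_{\mathbf a,\mathbf b}=\{(d_i)\in\{0,1\}^{\mathbb N}:\mathbf a\preccurlyeq\sigma^n((d_i))\preccurlyeq\mathbf b\ \forall n\ge0\}$. Define $\theta_m(\mathbf b)=\sup\{\mathbf a\in\{0,1\}^{\mathbb N}:\Sigma_{\mathbf a,\mathbf b}\text{ contains a periodic sequence of smallest period }m\}$ (supremum in the lexicographical order, with $\sup\emptyset=0^\infty$). To avoid the trivial case, $\mathbf b$ is assumed to begin with digit $1$. Admissible chains. $\mathcal A_m$ is the set of admissible $m$-chains: vectors $(m,k_1,\ldots,k_\ell)$ of positive integers with $k_i<m_i:=\gcd(m,k_1,\ldots,k_{i-1})$ for all $1\le i\le\ell$ (where $m_1=m$) and $\gcd(m,k_1,\ldots,k_\ell)=1$. For vectors of positive integers, $(a_1,\ldots,a_j)\prec(b_1,\ldots,b_l)$ means that there is $n\le\min\{j,l\}$ with $a_i=b_i$ for $1\le i<n$ and $a_n<b_n$. On $\mathcal A_m$ this is a total order with smallest element $(m,1)$ and largest element $(m,m-1)$. The function $\psi$ is defined by $\psi(1)=1$ and $\psi(n)=\sum_{k=1}^{n-1}\psi(\gcd(n,k))$ for $n\ge2$; one has $\#\mathcal A_m=\psi(m)$. Words. $\{0,1\}^*$ is the set of finite words over $\{0,1\}$. For a word $\mathbf w$, $\mathbf w^\infty=\mathbf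 w\mathbf w\cdots$, and $\mathbb L(\mathbf w)$ is the lexicographically largest cyclic permutation of $\mathbf w$. If $\mathbf w$ ends with $0$, $\mathbf w^+$ is $\mathbf w$ with last digit changed to $1$; if $\mathbf w$ ends with $1$, $\mathbf w^-$ is $\mathbf w$ with last digit changed to $0$. Farey words. For a rational $p/q\in(0,1)$ with $\gcd(p,q)=1$, let $R_{p/q}:\mathbb R/\mathbb Z\to\mathbb R/\mathbb Z$, $x\mapsto x+p/q\pmod 1$. The Farey word $\mathbf w_{p/q}=w_1\ldots w_q$ is given by $w_k=1$ if $0\in(R_{p/q}^{k-1}(0),R_{p/q}^k(0)]$ (arc of the circle), and $w_k=0$ otherwise; equivalently $w_k=\lfloor kp/q\rfloor-\lfloor (k-1)p/q\rfloor$. If $\gcd(p,q)=d>1$, $\mathbf w_{p/q}:=\mathbf w_{(p/d)/(q/d)}$. Lyndon words and substitution. A word is a Lyndon word if it is not a proper power of a shorter word and is the lexicographically smallest of its cyclic permutations; Farey words of length at least two are Lyndon words. For a Lyndon word $\mathbf s$ of length at least two (it begins with $0$ and ends with $1$) and $\mathbf r=r_1\ldots r_n\in\{0,1\}^*$, define $\mathbf s\bullet\mathbf r=\mathbf w_1\ldots\mathbf w_n$, where $\mathbf w_1=\mathbf s^-$ if $r_1=0$, $\mathbf w_1=\mathbb L(\mathbf s)^+$ if $r_1=1$, and for $1\le k<n$, $\mathbf w_{k+1}$ equals $\mathbb L(\mathbf s)$, $\mathbb L(\mathbf s)^+$, $\mathbf s^-$, $\mathbf s$ according as $r_kr_{k+1}=00,01,10,11$.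 The operation $\bullet$ is associative on Lyndon words of length at least two. Partition. For $(m,k_1,\ldots,k_j)\in\mathcal A_m$ put $\mathbf b_{m,k_1,\ldots,k_j}=\mathbb L(\mathbf w_{k_1/m_1}\bullet\cdots\bullet\mathbf w_{k_j/m_j})^\infty$, with $m_1=m$ and $m_i=\gcd(m,k_1,\ldots,k_{i-1})$ for $2\le i\le j$. These sequences partition $\{0,1\}^{\mathbb N}$ into the pairwise disjoint $m$-partition intervals $[0^\infty,\mathbf b_{m,1}]$, $(\mathbf b_{m,m-1},1^\infty]$ and $\mathbf I_{m,k_1,\ldots,k_j}$ with $(m,k_1,\ldots,k_j)\in\mathcal A_m\setminus\{(m,m-1)\}$, where $\mathbf I_{m,k_1,\ldots,k_j}=(\mathbf b_{m,k_1,\ldots,k_j},\mathbf b_{m,k_1',\ldots,k_l'}]$ is the set of $\mathbf z\in\{0,1\}^{\mathbb N}$ with $\mathbf b_{m,k_1,\ldots,k_j}\prec\mathbf z\preccurlyeq\mathbf b_{m,k_1',\ldots,k_l'}$, and $(m,k_1',\ldots,k_l')$ is the immediate successor of $(m,k_1,\ldots,k_j)$ in $(\mathcal A_m,\prec)$.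
   Formalization: The partition intervals are closed on the left and open on the right, i.e. (i) b ≺ b_{m,1}, (ii) b ≽ b_{m,m-1}, (iii) likewise, since θ_m already jumps at each b_{m,k_1,…,k_j}; e.g. θ_2((10)^∞) = (01)^∞, not 0^∞. *)

(* Defs.v *)
From HB Require Import structures.
From mathcomp Require Import all_boot all_order.
From mathcomp Require Import all_classical all_reals all_analysis.

Set Implicit Arguments.
Unset Strict Implicit.
Unset Printing Implicit Defensive.
Import Order.TTheory.

Local Open Scope nat_scope.
Local Open Scope classical_set_scope.

(* {0,1}^N with 0 = false and 1 = true: the product topology is that of
   [cantor_space], the order is the lexicographical order [big_lexi_order];
   positions are numbered from 0. *)
Definition binseq : Type := nat -> bool.
HB.instance Definition _ := Choice.on binseq.
HB.instance Definition _ := Topological.copy binseq cantor_space.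
HB.instance Definition _ :=
  Order.Total.copy binseq (big_lexi_order (fun _ : nat => bool)).

Definition zeros : binseq := fun=> false.

Definition bshift (x : binseq) : binseq := fun i => x i.+1.

Definition Sigma (a b : binseq) : set binseq :=
  [set x | forall n, (a <= iter n bshift x)%O /\ (iter n bshift x <= b)%O].

Definition smallest_period (m : nat) (x : binseq) : Prop :=
  [/\ 0 < m, iter m bshift x = x &
      forall k, 0 < k < m -> iter k bshift x <> x].

(* [supremum x0 A] is [x0] when [A] is empty. *)
Definition theta (m : nat) (b : binseq) : binseq :=
  supremum zeros [set a | exists2 x, Sigma a b x & smallest_period m x].

Definition discontinuities (f : binseq -> binseq) : set binseq :=
  [set b | ~ {for b, continuous f}].

(* The infinite repetition of [w] (meaningful for nonempty words only). *)
Definition winf (w : seq bool) : binseq := fun i => nth false w (i %% size w).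

Definition Lmax (w : seq bool) : seq bool :=
  \big[Order.max/(w : seqlexi bool)]_(i < size w) (rot i w : seqlexi bool).

Definition set_last (d : bool) (w : seq bool) : seq bool :=
  if w is x :: w' then rcons (belast x w') d else [::].

(* w^+ and w^- ; they are only applied to words ending with 0, resp. 1. *)
Definition wplus (w : seq bool) : seq bool := set_last true w.
Definition wminus (w : seq bool) : seq bool := set_last false w.

(* The letters w_1, ..., w_q are listed from index 0. *)
Definition farey_coprime (p q : nat) : seq bool :=
  mkseq (fun k => (k.+1 * p) %/ q - (k * p) %/ q == 1) q.

Definition farey (p q : nat) : seq bool :=
  farey_coprime (p %/ gcdn p q) (q %/ gcdn p q).

Definition bullet_head (s : seq bool) (d : bool) : seq bool :=
  if d then wplus (Lmax s) else wminus s.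

Definition bullet_step (s : seq bool) (d e : bool) : seq bool :=
  match d, e with
  | false, false => Lmax s
  | false, true => wplus (Lmax s)
  | true, false => wminus s
  | true, true => s
  end.

Definition bullet (s r : seq bool) : seq bool :=
  if r is d :: r' then bullet_head s d ++ flatten (pairmap (bullet_step s) d r')
  else [::].

(* The bracketing s_1 * (s_2 * (... * s_j)); the value at [::] is never used. *)
Fixpoint bullets (ss : seq (seq bool)) : seq bool :=
  match ss with
  | [::] => [::]
  | [:: s] => s
  | s :: ss' => bullet s (bullets ss')
  end.

(* The vector (m, k_1, ..., k_l) is given by [m] and [ks] = (k_1, ..., k_l);
   [mgcd m ks i] is gcd(m, k_1, ..., k_i), which is m_(i+1). *)
Definition mgcd (m : nat) (ks : seq nat) (i : nat) : nat :=
  foldl gcdn m (take i ks).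

(* k_(i+1) is [nth 0 ks i]. *)
Definition admissible (m : nat) (ks : seq nat) : Prop :=
  (forall i, i < size ks -> 0 < nth 0 ks i < mgcd m ks i) /\
  mgcd m ks (size ks) = 1.

(* A proper prefix is not comparable to the longer vector. *)
Definition vec_lt (u v : seq nat) : Prop :=
  exists n, [/\ n < minn (size u) (size v),
    forall i, i < n -> nth 0 u i = nth 0 v i & nth 0 u n < nth 0 v n].

Definition chain_lt (m : nat) (ks ks' : seq nat) : Prop :=
  vec_lt (m :: ks) (m :: ks').

Definition chain_succ (m : nat) (ks ks' : seq nat) : Prop :=
  [/\ admissible m ks', chain_lt m ks ks' &
      forall ls, admissible m ls -> ~ (chain_lt m ks ls /\ chain_lt m ls ks')].

Definition chain_word (m : nat) (ks : seq nat) : seq bool :=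
  bullets (mkseq (fun i => farey (nth 0 ks i) (mgcd m ks i)) (size ks)).

Definition bchain (m : nat) (ks : seq nat) : binseq :=
  winf (Lmax (chain_word m ks)).

(* The intervals are closed on the left and open on the right: [theta m] takes
   its new value already at [bchain m ks], because [Sigma] is defined with
   non-strict inequalities. See [theta2_bchain]. *)
Definition partition_interval (m : nat) (ks : seq nat) : set binseq :=
  [set z | exists ks', [/\ chain_succ m ks ks',
    (bchain m ks <= z)%O & (z < bchain m ks')%O]].

(* psi is defined by well-founded recursion, implemented with fuel; the
   defining equations are [psi1] and [psiE]. *)
Fixpoint psi_fuel (fuel n : nat) : nat :=
  if fuel is f.+1 then
    if n == 1 then 1 else \sum_(1 <= k < n) psi_fuel f (gcdn n k)
  else 0.

Definition psi (n : nat) : nat := psi_fuel n n.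

Lemma psi_fuelE f n : 0 < n <= f -> psi_fuel f n = psi n.
Proof.
rewrite /psi; elim/ltn_ind: n f => n IH [|f] /andP[n0 nf].
  by move: (leq_trans n0 nf).
case: n n0 nf IH => // n _ nf IH /=; case: ifP => // _.
apply: eq_big_nat => k /andP[k0 kn].
have g0 : 0 < gcdn n.+1 k by rewrite gcdn_gt0.
have gn : gcdn n.+1 k <= n.
  by apply: leq_trans (dvdn_leq k0 (dvdn_gcdr _ _)) _; rewrite -ltnS.
by rewrite !IH ?g0 ?ltnS ?gn // (leq_trans gn).
Qed.

Lemma psi1 : psi 1 = 1.
Proof. by []. Qed.

Lemma psiE n : 1 < n -> psi n = \sum_(1 <= k < n) psi (gcdn n k).
Proof.
case: n => [//|n] n1; rewrite {1}/psi /= (gtn_eqF n1).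
apply: eq_big_nat => k /andP[k0 kn].
apply: psi_fuelE; rewrite gcdn_gt0 /=.
by apply: leq_trans (dvdn_leq k0 (dvdn_gcdr _ _)) _; rewrite -ltnS.
Qed.

(* [Sigma a b] may contain [b] itself: the jump at b_(2,1) = (10)^oo is attained. *)
Lemma theta2_bchain : theta 2 (bchain 2 [:: 1]) = winf [:: false; true].
Proof.
have -> : bchain 2 [:: 1] = winf [:: true; false].
  rewrite /bchain (_ : Lmax _ = [:: true; false]) //.
  have -> : chain_word 2 [:: 1] = [:: false; true] by [].
  by rewrite /Lmax !big_ord_recl big_ord0 /=.
set x0 := winf [:: false; true]; set x1 := winf [:: true; false].
have s0 : bshift x0 = x1.
  by apply/funext => i; rewrite /bshift /x0 /x1 /winf /= !modn2 /=; case: odd.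
have s1 : bshift x1 = x0.
  by apply/funext => i; rewrite /bshift /x0 /x1 /winf /= !modn2 /=; case: odd.
have it n : iter n bshift x0 = (if odd n then x1 else x0).
  by elim: n => //= n ->; case: odd.
have lt01 : (x0 <= x1)%O.
  change (is_true (@Order.le _ (big_lexi_order (fun _ : nat => bool)) x0 x1)).
  rewrite leEbig_lexi_order.
  by have -> : first_diff x0 x1 = Some 0 by apply/first_diff_SomeP.
have per : smallest_period 2 x0.
  split; [by []| by rewrite it|].
  by case=> [//|[|//]] _ /= /(congr1 (fun f : binseq => f 0)); rewrite s0.
rewrite /theta; set A := (X in supremum _ X).
have Ax0 : A x0.
  by exists x0 => // n; rewrite it; case: odd.
have ubA : ubound A x0.
  move=> a [x ax [_ /= p2 p1]].
  have xE i : x i.+2 = x i by rewrite -{2}p2.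
  have x01 : x 1 = ~~ x 0.
    apply/eqP; rewrite eq_sym -addbT -[_ == _]negbK; apply/negP => e.
    apply: (p1 1) => //=; apply/funext => i; rewrite /bshift.
    have {}e : x 1 = x 0 by move: e; case: (x 0); case: (x 1).
    by elim: i => // i; rewrite xE => ->.
  have xi i : x i = if odd i then ~~ x 0 else x 0.
    by elim/ltn_ind: i => -[|[|i]] IH //; rewrite xE /= negbK IH.
  have [n xn] : exists n, iter n bshift x = x0.
    case E : (x 0).
      by exists 1; apply/funext => i; rewrite /= /bshift xi E /x0 /winf modn2 /=; case: odd.
    by exists 0; apply/funext => i; rewrite /= xi E /x0 /winf modn2; case: odd.
  by have [+ _] := ax n; rewrite xn.
have supA : supremums A x0 by split=> // y; apply.
rewrite /supremum ifF; last first.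
  by apply/negbTE/set0P; exists x0.
by apply: (is_subset1_supremums _ supA); case: xgetP => [y _ //|/(_ x0)].
Qed.

(* Main.v *)
Require Import Defs.
From mathcomp Require Import all_boot all_order finmap.
From mathcomp Require Import all_classical all_reals all_analysis.
From mathcomp Require Import zify.

(** For a periodic sequence [x], call the interval from the smallest to the
    largest point of its orbit the span of [x]. By definition [theta m b] is the
    largest left end of the spans of the sequences of smallest period [m] whose
    right end is at most [b], so only the innermost spans matter. They are the
    spans of the chain words, for three reasons.

    - The left end of the span of a chain word is the word itself, repeated, and
      its smallest period is [m] ([chain_factsP]).
    - Both ends strictly increase along the order on chains ([chain_mono]),
      which is total ([admissible_total]).
    - The span of every sequence of smallest period [m] contains the span of a
      chain word ([chain_inside]).

    Therefore [theta m b] is the chain word of the largest chain [ks] with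
    [bchain m ks <= b], or [zeros] if there is none ([theta_chain],
    [theta_zeros]): a step function that jumps exactly at the points [bchain].

    All comparisons are made on partial sums: a sequence whose partial sums never
    exceed those of another one is at most that one ([psum_lt], [psum_le_lex]). Let
    [P n] be the sum of the first [n] digits of a point of an orbit with [k]
    digits 1 per period, and [D n = m * P n - n * k] the deviation from the line of
    slope [k / m]. For a chain that begins with [k], the deviation stays in
    [[-m, 0]] from the smallest point and in [[0, m]] from the largest one
    ([slope_bounds]); these bounds alone order two chains whose first entries
    differ ([slope_bounds_lt]).

    For [chain_inside], let [x] have [k] digits 1 per period. If [D] somewhere
    drops by more than [m], then by periodicity it also rises somewhere by more
    than [m]. A shortest such drop starts at a point below every sequence that
    satisfies the bounds for smallest points, a shortest such rise at a
    point above every sequence that satisfies those for largest points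
    ([escape_below], [escape_above]). So the span of [x] contains that of every
    chain that begins with [k].

    Otherwise read [x] from a point where [D] is maximal: now [D] stays in [[-m, 0]].
    With [d = gcd(m, k)] and [q = m / d], this leaves no choice for the partial
    sums except at multiples of [q], where there are two. Recording these
    choices gives a sequence [R] of smallest period [d], of which [x] is the lift
    along the Farey word of slope [k / m] ([top_lift], [block_letters_period]).
    The lift is the operation by which chain words are built
    ([farey_lift_bullet]), and it respects the order, so a chain inside the span of
    [R], found by induction, lifts to one inside the span of [x]. *)

Set Implicit Arguments.
Unset Strict Implicit.
Unset Printing Implicit Defensive.
Import Order.TTheory.

Local Open Scope nat_scope.
Local Open Scope classical_set_scope.
Local Open Scope card_scope.

(** * Lexicographical order, shifts and partial sums *)

Lemma lt_binseqP (x y : binseq) : (x < y)%O <->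
  exists n, [/\ forall i, i < n -> x i = y i, x n = false & y n = true].
Proof.
have leE u v : (u <= v :> binseq)%O =
    if first_diff u v is Some n then (u n <= v n)%O else true by [].
rewrite lt_neqAle leE; split.
  case E : (first_diff x y) => [n|]; last first.
    by move/first_diff_NoneP : E => ->; rewrite eqxx.
  case/first_diff_SomeP : E => pre ne /andP[_ le]; exists n.
  by split; [move=> i /pre | move: le ne; case: (x n); case: (y n)..].
case=> n [pre xn yn]; have -> : first_diff x y = Some n.
  by apply/first_diff_SomeP; split=> [i /pre //|]; rewrite xn yn.
rewrite xn yn /= andbT; apply/eqP => e; by rewrite e yn in xn.
Qed.

Lemma iter_bshiftE n x i : iter n bshift x i = x (n + i).
Proof. by elim: n i => //= n IH i; rewrite /bshift IH addnS. Qed.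

Lemma iter_bshiftD m n x : iter m bshift (iter n bshift x) = iter (n + m) bshift x.
Proof. by rewrite addnC iterD. Qed.

Lemma periodicE m x : iter m bshift x = x -> forall t i, x (t * m + i) = x i.
Proof.
move=> per; elim=> // t IH i.
by rewrite mulSn -addnA -iter_bshiftE per IH.
Qed.

Lemma periodic_shift m x n t : iter m bshift x = x ->
  iter (t * m + n) bshift x = iter n bshift x.
Proof.
move=> per; apply/funext => i; by rewrite !iter_bshiftE -addnA periodicE.
Qed.

Lemma periodic_shiftn m x n : iter m bshift x = x ->
  iter m bshift (iter n bshift x) = iter n bshift x.
Proof. by move=> per; rewrite -{2}per !iter_bshiftD addnC. Qed.

Definition psum (x : binseq) n := \sum_(0 <= i < n) (x i : nat).

Lemma psum0 x : psum x 0 = 0.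
Proof. by rewrite /psum big_nil. Qed.

Lemma psumS x n : psum x n.+1 = psum x n + x n.
Proof. by rewrite /psum big_nat_recr. Qed.

Lemma psum1 x : psum x 1 = x 0.
Proof. by rewrite psumS psum0. Qed.

Lemma psum_le x n : psum x n <= n.
Proof. by elim: n => [|n IH]; rewrite ?psum0 // psumS; case: (x n); lia. Qed.

Lemma psumD x i n : psum x (i + n) = psum x i + psum (iter i bshift x) n.
Proof.
elim: n => [|n IH]; first by rewrite addn0 psum0; lia.
by rewrite addnS !psumS IH iter_bshiftE addnA.
Qed.

Lemma psum_shift x i n : psum (iter i bshift x) n = psum x (i + n) - psum x i.
Proof. by rewrite psumD addKn. Qed.

Lemma psum_eq x y n : (forall i, i < n -> x i = y i) -> psum x n = psum y n.
Proof.
by elim: n => [|n IH] e; rewrite ?psum0 // !psumS e ?IH // => i ?; apply: e; lia.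
Qed.

Lemma psum_inj x y : psum x =1 psum y -> x = y.
Proof.
move=> e; apply/funext => n; move: (e n.+1); rewrite !psumS e.
by case: (x n); case: (y n); lia.
Qed.

Lemma psumM m x t : iter m bshift x = x -> psum x (t * m) = t * psum x m.
Proof.
move=> per; elim: t => [|t IH]; first by rewrite psum0.
by rewrite mulSn psumD per IH mulSn.
Qed.

(** At the first place where two sequences differ, the larger one takes the
    larger partial sum. *)
Lemma psum_lt x y n : (forall j, j <= n -> psum x j <= psum y j) ->
  psum x n < psum y n -> (x < y)%O.
Proof.
move=> le lt; case: (ltgtP x y) => // [/lt_binseqP[i [pre yi xi]]|e]; last first.
  by rewrite e ltnn in lt.
have := psum_eq pre => e; case: (leqP i.+1 n) => [/le|ni].
  by rewrite !psumS yi xi e; lia.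
have: psum x n = psum y n by apply: psum_eq => j jn; rewrite pre //; lia.
by lia.
Qed.

Lemma psum_le_lex x y : (forall n, psum x n <= psum y n) -> (x <= y)%O.
Proof.
move=> le; rewrite leNgt; apply/negP => /lt_binseqP[n [pre yn xn]].
by have := le n.+1; rewrite !psumS yn xn (psum_eq pre); lia.
Qed.

Lemma bshift_lt (x y : binseq) : x 0 = y 0 -> (x < y)%O = (bshift x < bshift y)%O.
Proof.
move=> e0; apply/idP/idP => /lt_binseqP[n [pre xn yn]]; apply/lt_binseqP.
  case: n pre xn yn => [|n] pre xn yn; first by rewrite e0 yn in xn.
  by exists n; split=> // i ?; apply: pre.
by exists n.+1; split=> // -[//|i] ?; apply: pre.
Qed.

Lemma bshift_le (x y : binseq) : x 0 = y 0 -> (x <= y)%O = (bshift x <= bshift y)%O.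
Proof. by move=> e; rewrite !leNgt bshift_lt. Qed.

(** If [x] were larger, then up to the first place where [x] and its shift differ
    each digit would equal the next one, so all of them would be 0; but [x] would
    have the digit 1 at that place. *)
Lemma bshift_ge0 (x : binseq) : x 0 = false -> (x <= bshift x)%O.
Proof.
move=> x0; rewrite leNgt; apply/negP => /lt_binseqP[n [pre xn yn]].
have x0n i : i <= n -> x i = false.
  by elim: i => // i IH ?; rewrite -[x i.+1]/(bshift x i) pre // IH; lia.
by rewrite x0n in yn.
Qed.

Lemma bshift_le1 (x : binseq) : x 0 = true -> (bshift x <= x)%O.
Proof.
move=> x0; rewrite leNgt; apply/negP => /lt_binseqP[n [pre xn yn]].
have x0n i : i <= n -> x i = true.
  by elim: i => // i IH ?; rewrite -[x i.+1]/(bshift x i) -pre // IH; lia.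
by rewrite x0n in xn.
Qed.

(** * Words *)

Lemma winf_periodic w : iter (size w) bshift (winf w) = winf w.
Proof. by apply/funext => i; rewrite iter_bshiftE /winf modnDl. Qed.

Lemma winf_rot w n : n <= size w -> winf (rot n w) = iter n bshift (winf w).
Proof.
move=> nw; apply/funext => i; rewrite iter_bshiftE /winf size_rot.
case: (posnP (size w)) => [/size0nil e|w0]; first by rewrite e !nth_nil.
rewrite /rot nth_cat size_drop nth_drop -modnDmr.
have := ltn_pmod i w0; set j := i %% _ => jw; case: ltnP => c.
  by rewrite modn_small //; lia.
rewrite nth_take; last by lia.
by congr nth; rewrite (_ : n + j = j - (size w - n) + size w) ?modnDr ?modn_small; lia.
Qed.

Lemma winf_nth w i : i < size w -> winf w i = nth false w i.
Proof. by move=> iw; rewrite /winf modn_small. Qed.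

Lemma seqlexi_lt (v w : seqlexi bool) : size v = size w -> (v < w)%O ->
  exists n, [/\ n < size v, forall i, i < n -> nth false v i = nth false w i,
                nth false v n = false & nth false w n = true].
Proof.
elim: v w => [|a v IH] [|b w] //= [sz].
rewrite Order.SeqLexiOrder.ltxi_cons.
move=> /andP[ab /implyP imp]; case: (eqVneq a b) => [e|ne].
  have [|n [nv pre vn wn]] := IH w sz; first by apply: imp; rewrite e.
  by exists n.+1; split=> // -[|i] //=; apply: pre.
by exists 0; move: ab ne; case: (a); case: (b).
Qed.

Lemma winf_le (v w : seqlexi bool) : size v = size w -> (v <= w)%O ->
  (winf v <= winf w)%O.
Proof.
rewrite le_eqVlt => sz /orP[/eqP -> //|/(seqlexi_lt sz)[n [nv pre vn wn]]].
apply/ltW/lt_binseqP; exists n; rewrite !winf_nth -?sz //; split=> // i iv.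
by rewrite !winf_nth -?sz ?pre //; apply: ltn_trans nv.
Qed.

Lemma LmaxP w : 0 < size w -> exists2 i, i < size w & Lmax w = rot i w.
Proof.
move=> w0; rewrite /Lmax; elim/big_ind: _.
- by exists 0; rewrite ?rot0.
- by move=> u v [i iw ->] [j jw ->]; case: leP => _; [exists j | exists i].
- by move=> i _; exists i.
Qed.

Lemma size_Lmax w : size (Lmax w) = size w.
Proof.
case: (posnP (size w)) => [/size0nil ->|]; first by rewrite /Lmax big_ord0.
by case/LmaxP => i _ ->; rewrite size_rot.
Qed.

Lemma winf_shift_mod w n : 0 < size w ->
  iter n bshift (winf w) = iter (n %% size w) bshift (winf w).
Proof.
move=> w0; rewrite {1}(divn_eq n (size w)).
by rewrite periodic_shift // winf_periodic.
Qed.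

Lemma winf_Lmax_ge w n : 0 < size w -> (iter n bshift (winf w) <= winf (Lmax w))%O.
Proof.
move=> w0; rewrite winf_shift_mod // -winf_rot; last exact/ltnW/ltn_pmod.
apply: winf_le; first by rewrite size_rot size_Lmax.
exact: (le_bigmax (w : seqlexi bool) (fun i : 'I_(size w) => rot i w : seqlexi bool)
  (Ordinal (ltn_pmod n w0))).
Qed.

Lemma winf_Lmax_shift w : 0 < size w -> exists i, winf (Lmax w) = iter i bshift (winf w).
Proof. by case/LmaxP => i iw ->; exists i; rewrite winf_rot 1?ltnW. Qed.

Lemma winf_Lmax_unique w z : 0 < size w -> (exists i, z = iter i bshift (winf w)) ->
  (forall i, (iter i bshift (winf w) <= z)%O) -> winf (Lmax w) = z.
Proof.
move=> w0 [i zE] ub; apply/le_anti; rewrite zE winf_Lmax_ge // andbT -zE.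
by have [j ->] := winf_Lmax_shift w0.
Qed.

(** * Farey words *)

Section Farey.
Variables (p q : nat).
Hypotheses (p0 : 0 < p) (pq : p < q).

Lemma divn_step n : n.+1 * p %/ q = n * p %/ q + (n.+1 * p %/ q - n * p %/ q == 1).
Proof.
have q0 : 0 < q by lia.
have le : n * p %/ q <= n.+1 * p %/ q by apply: leq_div2r; lia.
have: n.+1 * p %/ q < n * p %/ q + 2.
  by rewrite ltn_divLR //; have := divn_eq (n * p) q; have := ltn_pmod (n * p) q0; nia.
by case: eqP => ? /=; lia.
Qed.

Lemma divn_start j : (j * q).+1 * p %/ q = j * p.
Proof.
have -> : (j * q).+1 * p = j * p * q + p by nia.
by rewrite divnMDl ?divn_small //; lia.
Qed.

Lemma divn_end j : (j * q + q.-1) * p %/ q = j * p + p.-1.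
Proof.
have -> : (j * q + q.-1) * p = (j * p + p.-1) * q + (q - p) by nia.
by rewrite divnMDl ?divn_small //; lia.
Qed.

Lemma divn_block j e : (j * q + e) * p %/ q = j * p + e * p %/ q.
Proof. by rewrite mulnDl mulnAC divnMDl //; lia. Qed.

Lemma size_farey : size (farey_coprime p q) = q.
Proof. by rewrite size_mkseq. Qed.

Lemma nth_farey e : e < q ->
  nth false (farey_coprime p q) e = (e.+1 * p %/ q - e * p %/ q == 1).
Proof. by move=> eq; rewrite nth_mkseq. Qed.

(** A Farey word of length at least two has the form [0u1]. *)
Lemma nth_farey_ends : nth false (farey_coprime p q) 0 = false /\
  nth false (farey_coprime p q) q.-1 = true.
Proof.
have q0 : 0 < q := leq_ltn_trans (leq0n p) pq.
split; rewrite nth_farey ?ltn_predL //.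
  by have := divn_start 0; rewrite !mul0n => ->; rewrite div0n.
rewrite prednK // mulKn //.
by have := divn_end 0; rewrite !mul0n !add0n => ->; lia.
Qed.

Lemma winf_farey n :
  winf (farey_coprime p q) n = (n.+1 * p %/ q - n * p %/ q == 1).
Proof.
rewrite /winf size_farey nth_farey ?ltn_pmod //; last lia.
rewrite {3 4}(divn_eq n q) -addnS !divn_block.
by congr (_ == 1); lia.
Qed.

Lemma psum_farey n : psum (winf (farey_coprime p q)) n = n * p %/ q.
Proof.
elim: n => [|n IH]; first by rewrite psum0 mul0n div0n.
by rewrite psumS IH winf_farey -divn_step.
Qed.

(** Rotating by [i] with [i * p = -1] modulo [q] turns floors into ceilings. *)
Lemma farey_ceil_shift : coprime p q -> exists i, forall n,
  psum (iter i bshift (winf (farey_coprime p q))) n = (n * p + q.-1) %/ q.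
Proof.
move=> copr; case: (@egcdnP q p) => [|u v e _]; first lia.
rewrite gcdnC (eqP copr) in e; exists v => n.
rewrite psum_shift !psum_farey.
have q0 : 0 < q by lia.
case: u e => [|u] e; first by rewrite mul0n in e; lia.
have vp : v * p = u * q + q.-1 by move: e; rewrite mulSn; lia.
have -> : (v + n) * p = u * q + (n * p + q.-1) by rewrite mulnDl vp; lia.
rewrite vp.
by rewrite !divnMDl // (divn_small (m := q.-1)); [lia | rewrite ltn_predL].
Qed.

Lemma psum_farey_shift_ge i n :
  n * p %/ q <= psum (iter i bshift (winf (farey_coprime p q))) n.
Proof.
rewrite psum_shift !psum_farey mulnDl.
by rewrite divnD; lia.
Qed.

End Farey.

(** * Lifting a sequence along a Farey word *)

(** With [w = 0u1] the Farey word of slope [p / q], the lift of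
    [R = R_0 R_1 ...] is [~R_0 u R_1 ~R_1 u R_2 ~R_2 u ...]. It is described by
    its partial sums: up to the constant [~R_0], they are those of the Farey word,
    less one at the multiples [j * q] with [R_j = 0]. *)
Definition farey_lift p q (R x : binseq) := forall n,
  psum x n + ((q %| n) && ~~ R (n %/ q)) = n * p %/ q + ~~ R 0.

Definition bcons (c : bool) (x : binseq) : binseq :=
  fun i => if i is i'.+1 then x i' else c.

Lemma bshift_cons c x : bshift (bcons c x) = x.
Proof. by []. Qed.

Section Lift.
Variables (p q : nat).
Hypotheses (p0 : 0 < p) (pq : p < q).

Let q0 : 0 < q. Proof. by lia. Qed.

Lemma farey_lift_mulq R x j : farey_lift p q R x ->
  psum x (j * q) + ~~ R j = j * p + ~~ R 0.
Proof. by move/(_ (j * q)); rewrite dvdn_mull // mulnK // mulnAC mulnK. Qed.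

Lemma farey_lift_shift R x j : farey_lift p q R x ->
  farey_lift p q (iter j bshift R) (iter (j * q) bshift x).
Proof.
move=> L n; rewrite !iter_bshiftE addn0.
have := farey_lift_mulq j L; have := L (j * q + n).
rewrite psumD dvdn_addr ?dvdn_mull // divnMDl // divn_block //; lia.
Qed.

Lemma farey_lift_inj R x R' x' : farey_lift p q R x -> farey_lift p q R' x' ->
  R 0 = R' 0 -> (x = x') <-> (R = R').
Proof.
move=> L L' e0; split=> e.
  apply/funext => j; have := farey_lift_mulq j L; have := farey_lift_mulq j L'.
  by rewrite e e0; case: (R j); case: (R' j); lia.
by apply: psum_inj => n; have := L n; have := L' n; rewrite e; lia.
Qed.

(** The partial sums of two lifts first differ at the end of the block of the first
    different letter. *)
Lemma farey_lift_lt R x R' x' : farey_lift p q R x -> farey_lift p q R' x' ->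
  R 0 = R' 0 -> (R < R')%O -> (x < x')%O.
Proof.
move=> L L' e0 /lt_binseqP[j [pre Rj R'j]]; apply: (@psum_lt _ _ (j * q)).
  move=> n nj; have := L n; have := L' n; rewrite e0.
  case: (ltnP (n %/ q) j) => [/pre ->|]; first lia.
  rewrite leq_divRL // => jn; have -> : n = j * q by lia.
  by rewrite mulnK // R'j andbF; lia.
by have := farey_lift_mulq j L; have := farey_lift_mulq j L'; rewrite e0 Rj R'j; lia.
Qed.

Lemma farey_lift_le R x R' x' : farey_lift p q R x -> farey_lift p q R' x' ->
  R 0 = R' 0 -> (R <= R')%O -> (x <= x')%O.
Proof.
move=> L L' e0; rewrite le_eqVlt => /orP[/eqP e|/(farey_lift_lt L L' e0)/ltW //].
by have [_ ->] := farey_lift_inj L L' e0.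
Qed.

Lemma farey_lift1_bounds R x n : farey_lift p q R x -> R 0 = true ->
  n * p <= q * (psum x n).+1 /\ q * psum x n <= n * p.
Proof.
move=> /(_ n) L R0; move: L; rewrite R0 /= addn0 => L.
have := divn_eq (n * p) q; have := ltn_pmod (n * p) q0; rewrite -L.
case: (boolP (q %| n)) => qn /=; last nia.
have /eqP-> : (n * p) %% q == 0 by rewrite -/(dvdn _ _) dvdn_mulr.
by case: (R _); rewrite /=; nia.
Qed.

Lemma farey_lift1_strict R x n : coprime p q -> farey_lift p q R x ->
  R 0 = true -> ~~ (q %| n) ->
  n * p < q * (psum x n).+1 /\ q * psum x n < n * p.
Proof.
move=> copr /(_ n) L R0 qn; move: L; rewrite R0 (negbTE qn) /= !addn0 => L.
have := divn_eq (n * p) q; have := ltn_pmod (n * p) q0; rewrite -L.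
have : (n * p) %% q != 0.
  by rewrite -/(dvdn _ _) Gauss_dvdl // coprime_sym.
by nia.
Qed.

Lemma farey_lift0_bounds R x n : farey_lift p q R x -> R 0 = false -> 0 < n ->
  n * p <= q * psum x n /\ q * psum x n <= n * p + q.
Proof.
move=> /(_ n) L R0 n0; move: L; rewrite R0 /= => L.
have := divn_eq (n * p) q; have := ltn_pmod (n * p) q0.
move: L; case: (boolP (q %| n)) => qn /=; last by rewrite addn0 => ->; nia.
have /eqP-> : (n * p) %% q == 0 by rewrite -/(dvdn _ _) dvdn_mulr.
by move: (n * p %/ q) (R _) => t [] /= e _ ->; nia.
Qed.

End Lift.

(** * The substitution produces lifts *)

Lemma nth_flatten_block (T : Type) (x0 : T) q ss j e :
  all (fun s => size s == q) ss -> e < q -> j < size ss ->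
  nth x0 (flatten ss) (j * q + e) = nth x0 (nth [::] ss j) e.
Proof.
move=> + eq; elim: ss j => //= s ss IH [|j] /andP[/eqP sz al] js.
  by rewrite nth_cat sz eq.
rewrite nth_cat sz mulSn -addnA ltnNge leq_addr /= addKn.
exact: IH.
Qed.

Lemma size_flatten_block (T : Type) q (ss : seq (seq T)) :
  all (fun s => size s == q) ss -> size (flatten ss) = size ss * q.
Proof. by elim: ss => //= s ss IH /andP[/eqP sz /IH e]; rewrite size_cat sz e mulSn. Qed.

Lemma size_set_last d w : size (set_last d w) = size w.
Proof. by case: w => //= x w; rewrite size_rcons size_belast. Qed.

Lemma nth_set_last d w i : i < size w ->
  nth false (set_last d w) i = if i == (size w).-1 then d else nth false w i.
Proof.
case: w => // x w; rewrite [size _]/= ltnS => iw.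
have -> : set_last d (x :: w) = rcons (belast x w) d by [].
rewrite (lastI x w) !nth_rcons size_belast [_.-1]/=.
by case: ltngtP iw => //; rewrite ltnNge => /negbTE ->.
Qed.

Section Bullet.
Variables (p q : nat).
Hypotheses (p0 : 0 < p) (pq : p < q) (copr : coprime p q).
Let s := farey_coprime p q.

Let q0 : 0 < q. Proof. by lia. Qed.

(** The ceilings [ceil (n * p / q)] are partial sums of a rotation of the Farey
    word, and they bound the partial sums of all of them. *)
Lemma psum_Lmax_farey n : psum (winf (Lmax s)) n = (n * p + q.-1) %/ q.
Proof.
have [i iP] := farey_ceil_shift p0 pq copr.
rewrite -iP; congr psum; apply: winf_Lmax_unique; first by rewrite size_farey.
  by exists i.
move=> j; apply: psum_le_lex => k; rewrite iP psum_shift !psum_farey // mulnDl.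
rewrite leq_subLR divnD // -addnA leq_add2l divnD //.
rewrite (divn_small (m := q.-1)) ?ltn_predL // addn0 (modn_small (m := q.-1)) ?ltn_predL //.
rewrite leq_add2l; have := ltn_pmod (j * p) q0; lia.
Qed.

(** The largest rotation of [0u1] is [1u0]: floors and ceilings of [n * p / q]
    differ by one unless [q] divides [n], so they have the same increments
    away from the ends of the word. *)
Lemma nth_Lmax_farey e : e < q -> nth false (Lmax s) e =
  if e == 0 then true else if e == q.-1 then false else nth false s e.
Proof.
move=> eq; have szL : size (Lmax s) = q by rewrite size_Lmax size_farey.
rewrite -!winf_nth ?szL ?size_farey //.
have := psumS (winf (Lmax s)) e; have := psumS (winf s) e.
rewrite !psum_Lmax_farey !psum_farey //.
have ceilE n : 0 < n < q -> (n * p + q.-1) %/ q = (n * p %/ q).+1.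
  move=> nq; have : ~~ (q %| n * p).
    by rewrite Gauss_dvdl 1?coprime_sym // gtnNdvd; lia.
  rewrite -[_.+1]addn1 divnD // (divn_small (m := q.-1)) ?ltn_predL // addn0.
  rewrite (modn_small (m := q.-1)) ?ltn_predL // /dvdn; case: leqP; lia.
have q1 : 1 < q by lia.
case: (posnP e) => [->|e0].
  move=> _; rewrite ceilE ?q1 // mul1n mul0n add0n (divn_small pq).
  by rewrite divn_small ?ltn_predL //; case: (winf _ _).
case: eqP => [ee|ne];
  last by rewrite !ceilE; [case: (winf s e); case: (winf _ e); lia | lia..].
have e1q : e.+1 = q by lia.
move=> _; rewrite e1q (ceilE e); last lia.
rewrite (mulnC q) divnMDl // (divn_small (m := q.-1)) ?ltn_predL //.
have := divn_end p0 pq 0; rewrite !mul0n !add0n -ee => ->.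
by case: (winf _ e); lia.
Qed.

(** This is what makes the four cases of [bullet_step] uniform: if [s = 0u1], the
    block for the letters [d e] is [~d u e]. *)
Lemma nth_bullet_step d e i : i < q -> nth false (bullet_step s d e) i =
  if i == 0 then ~~ d else if i == q.-1 then e else nth false s i.
Proof.
have [s0 s1] := nth_farey_ends p0 pq; rewrite -/s in s0 s1.
move=> iq; case: d; case: e; rewrite /= /wplus /wminus.
- by case: eqP => [->|_] //; case: eqP => [->|].
- rewrite nth_set_last size_farey //; case: eqP => [->|_]; case: eqP => // ->; lia.
- rewrite nth_set_last size_Lmax size_farey // nth_Lmax_farey //.
  by case: eqP => [->|_]; case: eqP => //; lia.
- exact: nth_Lmax_farey.
Qed.

Lemma size_bullet_step d e : size (bullet_step s d e) = q.
Proof.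
by case: d; case: e; rewrite /= ?size_set_last ?size_Lmax size_farey.
Qed.

(** The initial block [s^-] is the block that follows a letter 1, so an initial 0
    is treated as if it were preceded by 1. *)
Lemma bullet_flatten r : nth true r 0 = false ->
  bullet s r = flatten (pairmap (bullet_step s) true r).
Proof. by case: r => [|[] r]. Qed.

Lemma size_bullet_blocks r a :
  all (fun t => size t == q) (pairmap (bullet_step s) a r).
Proof. by elim: r a => //= d r IH a; rewrite size_bullet_step eqxx IH. Qed.

Lemma size_bullet r : nth true r 0 = false -> size (bullet s r) = size r * q.
Proof.
move=> /bullet_flatten ->.
by rewrite (size_flatten_block (size_bullet_blocks _ _)) size_pairmap.
Qed.

Lemma winf_bullet r j e : nth true r 0 = false -> last true r = true -> e < q ->
  let R := bcons true (winf r) in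
  winf (bullet s r) (j * q + e) =
  if e == 0 then ~~ R j else if e == q.-1 then R j.+1 else nth false s e.
Proof.
move=> r0 rl eq R; rewrite /winf size_bullet //.
have n0 : 0 < size r by case: (r) r0.
have jn := ltn_pmod j n0.
rewrite {1}(divn_eq j (size r)) mulnDl -mulnA -addnA modnMDl modn_small; last first.
  by have : (j %% size r).+1 * q <= size r * q; [rewrite leq_mul2r jn orbT | lia].
rewrite bullet_flatten // (nth_flatten_block _ (size_bullet_blocks _ _)) ?size_pairmap //.
rewrite (nth_pairmap false) // nth_bullet_step //.
have -> : nth false (true :: r) (j %% size r) = R j; last by [].
case: j {jn} => [|j]; first by rewrite mod0n.
rewrite /R /= /winf modnS; case: ifP => /= [|_]; last by [].
have nn : (j %% size r) < size r by rewrite ltn_pmod.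
rewrite /dvdn -addn1 -modnDml addn1 => d.
have -> : j %% size r = (size r).-1.
  by have /dvdn_leq : size r %| (j %% size r).+1 by []; lia.
by rewrite nth_last; case: (r) rl n0.
Qed.

(** In the infinite repetition of [bullet s r] each copy of [r] is preceded by the
    last letter 1 of the previous copy, which agrees with the letter 1 put in
    front of the first block; so the word is the lift of [1 r r r ...]. *)
Lemma farey_lift_bullet r : nth true r 0 = false -> last true r = true ->
  farey_lift p q (bcons true (winf r)) (winf (bullet s r)).
Proof.
move=> r0 rl; elim=> [|n IH]; first by rewrite psum0 dvdn0 div0n.
rewrite [~~ bcons _ _ 0]/= addn0 in IH *.
rewrite psumS; move: IH; have eq := ltn_pmod n q0.
rewrite (divn_eq n q); set j := n %/ q; set e := n %% q.
rewrite winf_bullet // -addnS !divn_block // dvdn_addr ?dvdn_mull //.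
rewrite divnMDl // (divn_small eq) addn0 divnMDl //.
rewrite dvdn_addr ?dvdn_mull //.
have [s0 s1] := nth_farey_ends p0 pq; rewrite -/s in s0 s1.
have [e1|e1] := eqVneq e.+1 q.
  have -> : e = q.-1 by lia.
  rewrite prednK // dvdnn divnn q0 addn1 eqxx mulKn //.
  have -> : (q.-1 == 0) = false by lia.
  have := divn_end p0 pq 0; rewrite !mul0n !add0n => ->.
  by rewrite gtnNdvd ?ltn_predL //; [case: (bcons _ _ _) => /=; lia | lia].
have e1q : e.+1 < q by lia.
rewrite (gtnNdvd _ e1q) // (divn_small e1q) addn0.
have -> : (e == q.-1) = false by lia.
case: (posnP e) => [->|e0].
  rewrite dvdn0 mul0n div0n mul1n divn_small //.
  by case: (bcons _ _ _) => /=; lia.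
by rewrite gtnNdvd // nth_farey // (divn_step p0 pq e) /=; lia.
Qed.

End Bullet.

(** * Orbits of lifts *)

Lemma bcons_periodic d c x : 0 < d -> iter d bshift x = x -> x d.-1 = c ->
  bcons c x = iter d.-1 bshift x.
Proof.
move=> d0 per xd; apply/funext => -[|i]; rewrite iter_bshiftE ?addn0 //=.
by rewrite addnS -addSn prednK // -iter_bshiftE per.
Qed.

Lemma iter_bshift_cons j c x : bshift (iter j bshift (bcons c x)) = iter j bshift x.
Proof. by rewrite -iterS iterSr bshift_cons. Qed.

Section LiftOrbit.
Variables (p q : nat) (a' a : binseq).
Hypotheses (p0 : 0 < p) (pq : p < q) (copr : coprime p q).
Hypothesis La : farey_lift p q (bcons true a') a.

Let q0 : 0 < q := leq_ltn_trans (leq0n p) pq.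
Let R := bcons true a'.

(** A shift of [a] by a multiple of [q] is a lift of a shift of [R]. If that one
    begins with 1, as [R] does, the lift preserves their order; if it begins
    with 0, its partial sums lie above the line of slope [p / q] and those of [a]
    below. Any other shift starts strictly between the two lines that
    enclose the partial sums of [a], which leaves it at least the floor of
    [i * p / q]. *)
Lemma farey_lift_orbit_min n :
  (forall i, (a' <= iter i bshift a')%O) -> (a <= iter n bshift a)%O.
Proof.
move=> a'min; have [/dvdnP[j ->]|qn] := boolP (q %| n).
  have L := farey_lift_shift p0 pq j La.
  have L0 : iter j bshift R 0 = R j by rewrite iter_bshiftE addn0.
  case Rj : (R j); last first.
    apply: psum_le_lex => i; case: (posnP i) => [->|i0]; first by rewrite !psum0.
    have [_ b1] := farey_lift1_bounds p0 pq i La erefl.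
    have [b2 _] := farey_lift0_bounds p0 pq L (etrans L0 Rj) i0.
    by move: (leq_trans b1 b2); rewrite leq_pmul2l.
  apply: (farey_lift_le p0 pq La L); first by rewrite L0 Rj.
  rewrite bshift_le; last by rewrite L0 Rj.
  by rewrite bshift_cons iter_bshift_cons.
apply: psum_le_lex => i.
have [s1 s2] := farey_lift1_strict p0 pq copr La erefl qn.
have [_ b1] := farey_lift1_bounds p0 pq i La erefl.
have [b2 _] := farey_lift1_bounds p0 pq (n + i) La erefl.
rewrite -ltnS -(ltn_pmul2l q0); apply: leq_ltn_trans b1 _.
by move: b2; rewrite psumD mulnDl; lia.
Qed.

(** The mirror image of [farey_lift_orbit_min]: the largest point begins at a
    letter 0 of [R]. *)
Lemma farey_lift_orbit_max b' z n :
  (forall i, (iter i bshift a' <= b')%O) ->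
  farey_lift p q (bcons false b') z -> (iter n bshift a <= z)%O.
Proof.
move=> b'max Lz; have [/dvdnP[j ->]|qn] := boolP (q %| n).
  have L := farey_lift_shift p0 pq j La.
  have L0 : iter j bshift R 0 = R j by rewrite iter_bshiftE addn0.
  case Rj : (R j).
    apply: psum_le_lex => i; case: (posnP i) => [->|i0]; first by rewrite !psum0.
    have [_ b1] := farey_lift1_bounds p0 pq i L (etrans L0 Rj).
    have [b2 _] := farey_lift0_bounds p0 pq Lz erefl i0.
    by move: (leq_trans b1 b2); rewrite leq_pmul2l.
  apply: (farey_lift_le p0 pq L Lz); first by rewrite L0 Rj.
  rewrite bshift_le; last by rewrite L0 Rj.
  by rewrite bshift_cons iter_bshift_cons.
apply: psum_le_lex => i; case: (posnP i) => [->|i0]; first by rewrite !psum0.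
have [s1 s2] := farey_lift1_strict p0 pq copr La erefl qn.
have [b1 _] := farey_lift0_bounds p0 pq Lz erefl i0.
have [_ b2] := farey_lift1_bounds p0 pq (n + i) La erefl.
rewrite -ltnS -(ltn_pmul2l q0).
by move: b2; rewrite psumD mulnDl; lia.
Qed.

Variable d : nat.
Hypotheses (per : smallest_period d a') (a'l : a' d.-1 = true).

Let RE : R = iter d.-1 bshift a'.
Proof. by case: per => d0 e _; apply: bcons_periodic. Qed.

Let R_periodic : iter d bshift R = R.
Proof. by case: per => d0 e _; rewrite RE periodic_shiftn. Qed.

(** A period [t] of [a] has the same mean as the period [d * q], so [q] divides
    [t] and the partial sum at [t] is on the line of slope [p / q]. Hence the
    shift by [t] is a shift of [R] by whole letters that begins with 1. *)
Lemma farey_lift_smallest_period : smallest_period (d * q) a.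
Proof.
case: per => d0 e min.
have perdq : iter (d * q) bshift a = a.
  have := farey_lift_shift p0 pq d La; rewrite R_periodic => L.
  by have [_ ->] := farey_lift_inj p0 pq L La erefl.
split=> [||t /andP[t0 tdq] et]; [by rewrite muln_gt0 d0 | by [] |].
have e1 : psum a (d * q) = d * p.
  have := farey_lift_mulq p0 pq d La; rewrite -/R.
  have -> : R d = R 0 by rewrite -[in RHS]R_periodic iter_bshiftE addn0.
  by rewrite /R /= !addn0.
have qt : q * psum a t = t * p.
  have := psumM t perdq; rewrite e1 mulnC (psumM _ et) => /eqP.
  by rewrite -mulnA [eqbRHS]mulnCA eqn_pmul2l // => /eqP.
have /dvdnP[j tE] : q %| t.
  by rewrite -(Gauss_dvdl t (p := p)) 1?coprime_sym // -qt dvdn_mulr.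
have Rj : R j = true.
  have := farey_lift_mulq p0 pq j La; rewrite -tE -/R.
  have -> : psum a t = j * p.
    by apply/eqP; rewrite -(eqn_pmul2l q0) qt tE; apply/eqP; nia.
  by case: (R j) => //=; lia.
have := farey_lift_shift p0 pq j La; rewrite -tE et => L.
have e0 : iter j bshift R 0 = R 0 by rewrite iter_bshiftE addn0.
have [/(_ erefl)/(congr1 bshift) + _] := farey_lift_inj p0 pq L La e0.
by rewrite iter_bshift_cons bshift_cons; apply: min; nia.
Qed.

(** Since [b'] ends its period with 0, putting 0 in front of it gives a shift of
    [R], and the lift of that one is a shift of [a]. *)
Lemma farey_lift_max_shift b' : (exists j, b' = iter j bshift a') ->
  b' d.-1 = false -> exists i, farey_lift p q (bcons false b') (iter i bshift a).
Proof.
case: per => d0 e _ [j b'E] b'l; exists (j * q).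
rewrite (_ : bcons false b' = iter j bshift R); first exact: farey_lift_shift.
rewrite (@bcons_periodic d) // b'E; first by rewrite RE !iter_bshiftD addnC.
by rewrite periodic_shiftn.
Qed.

End LiftOrbit.

(** * Admissible chains *)

Lemma admissible_nil m : admissible m [::] <-> m = 1.
Proof. by split=> [[]|]. Qed.

Lemma admissible_cons m k ks :
  admissible m (k :: ks) <-> 0 < k < m /\ admissible (gcdn m k) ks.
Proof.
split=> [[lt e]|[kn [lt e]]].
  by split; [exact: (lt 0) | split=> // i ?; exact: (lt i.+1)].
by split=> // -[|i] //= ?; exact: (lt i).
Qed.

Lemma chain_word1 m k : chain_word m [:: k] = farey k m.
Proof. by []. Qed.

Lemma chain_word_cons m k k' ks : chain_word m [:: k, k' & ks] =
  bullet (farey k m) (chain_word (gcdn m k) (k' :: ks)).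
Proof. by rewrite /chain_word /mkseq /= (iotaDl 1 1) (iotaDl 1 0) -!map_comp. Qed.

Lemma reduced_slope m k (p := k %/ gcdn m k) (q := m %/ gcdn m k) :
  0 < k < m -> [/\ 0 < p, p < q, coprime p q, k = p * gcdn m k & m = q * gcdn m k].
Proof.
move=> /andP[k0 km]; have d0 : 0 < gcdn m k by rewrite gcdn_gt0 k0 orbT.
have kE : k = p * gcdn m k by rewrite divnK ?dvdn_gcdr.
have mE : m = q * gcdn m k by rewrite divnK ?dvdn_gcdl.
split=> //; first by rewrite divn_gt0 // dvdn_leq // dvdn_gcdr.
  by rewrite -(ltn_pmul2r d0) -kE -mE.
by rewrite /coprime -(eqn_pmul2r d0) mul1n muln_gcdl -kE -mE gcdnC.
Qed.

Lemma fareyE m k : farey k m = farey_coprime (k %/ gcdn m k) (m %/ gcdn m k).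
Proof. by rewrite /farey gcdnC. Qed.

(** Here [a] and [b] are meant to be the smallest and the largest point of an orbit:
    from [a] the partial sums stay within distance one below the line of slope
    [k / m], from [b] within distance one above it. *)
Definition slope_bounds m k (a b : binseq) :=
  (forall n, n * k <= m * (psum a n).+1 /\ m * psum a n <= n * k) /\
  (forall n, 0 < n -> n * k <= m * psum b n /\ m * psum b n <= n * k + m).

(** These digits let a word serve as second factor of [bullet], and tell which
    letter precedes the smallest and the largest point in their orbit. *)
Lemma slope_bounds_digits m k a b : 0 < k < m ->
  iter m bshift a = a -> iter m bshift b = b -> slope_bounds m k a b ->
  [/\ a 0 = false, a m.-1 = true, b 0 = true & b m.-1 = false].
Proof.
move=> /andP[k0 km] pera perb [Ba Bb]; have m0 : 0 < m by lia.
have mm : m = m.-1.+1 by lia.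
(* The bounds leave a slack of one, which two periods reduce to less than one
   per period. *)
have Pa : psum a m = k.
  have [_ h1] := Ba m; have [h2 _] := Ba (2 * m).
  move: h1 h2; rewrite (psumM _ pera) leq_pmul2l // -mulnA mulnCA leq_pmul2l //; lia.
have Pb : psum b m = k.
  have [h1 _] := Bb m m0; have [|_ h2] := Bb (2 * m); first lia.
  move: h1 h2; rewrite (psumM _ perb) leq_pmul2l //.
  rewrite -mulnA (mulnCA 2) -[X in _ + X]muln1 -mulnDr leq_pmul2l //; lia.
split.
- have [_] := Ba 1; rewrite psum1 mul1n; case: (a 0) => //; lia.
- have [_ h] := Ba m.-1; move: Pa; rewrite mm psumS -mm; case: (a _) => //= e.
  by move: h; rewrite -(addn0 (psum _ _)) e; nia.
- have [h _] := Bb 1 isT; move: h; rewrite psum1 mul1n; case: (b 0) => //; lia.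
- have [|h _] := Bb m.-1; first lia.
  move: Pb; rewrite {1}mm psumS; case: (b _) => //= e.
  by move: h; rewrite (_ : psum b m.-1 = k.-1); [nia | lia].
Qed.

(** What the induction along a chain with first entry [k] needs to know about its
    word [w]. *)
Record chain_facts m k (w : seq bool) : Prop := ChainFacts {
  chain_size : size w = m;
  chain_period : smallest_period m (winf w);
  chain_min : forall n, (winf w <= iter n bshift (winf w))%O;
  chain_slope : slope_bounds m k (winf w) (winf (Lmax w)) }.

Lemma chain_digits m k w : 0 < k < m -> chain_facts m k w ->
  [/\ winf w 0 = false, winf w m.-1 = true,
      winf (Lmax w) 0 = true & winf (Lmax w) m.-1 = false].
Proof.
move=> km [sz [_ per _] _ sl]; apply: slope_bounds_digits (sl) => //.
by rewrite -{1}sz -size_Lmax winf_periodic.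
Qed.

Lemma chain_facts_base m k : 0 < k < m -> coprime m k -> chain_facts m k (farey k m).
Proof.
move=> km copr; have [k0 lkm] := andP km.
rewrite fareyE (eqP copr) !divn1; have copr' : coprime k m by rewrite coprime_sym.
have m0 : 0 < m by lia.
split; first exact: size_farey.
- split=> //; first by rewrite -{1}(size_farey k m) winf_periodic.
  move=> t /andP[t0 tm] et; have := psumM m et.
  have := psumM t (x := winf (farey_coprime k m)) (m := m).
  rewrite -{1}(size_farey k m) winf_periodic mulnC => /(_ erefl) ->.
  rewrite !psum_farey // mulKn // => e.
  have : m %| t by rewrite -(Gauss_dvdl t (p := k)) // e dvdn_mulr.
  by move/dvdn_leq => /(_ t0); lia.
- move=> n; apply: psum_le_lex => i.
  by rewrite psum_farey // psum_farey_shift_ge.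
split=> n.
  rewrite psum_farey // ![m * _]mulnC leq_trunc_div; split=> //.
  by apply: ltnW; rewrite ltn_ceil.
move=> n0; rewrite psum_Lmax_farey //.
have := divn_eq (n * k + m.-1) m; have := ltn_pmod (n * k + m.-1) m0.
by rewrite [_ * m]mulnC; lia.
Qed.

Section ChainStep.
Variables (m k k' : nat) (w' : seq bool).
Hypotheses (km : 0 < k < m).
Let d := gcdn m k.
Let p := k %/ d.
Let q := m %/ d.
Hypotheses (k'd : 0 < k' < d) (F : chain_facts d k' w').
Let w := bullet (farey k m) w'.

Lemma chain_step_ends : nth true w' 0 = false /\ last true w' = true.
Proof.
have d0 : 0 < d by lia.
have [a0 al _ _] := chain_digits k'd F; have sz := chain_size F.
move: a0 al; rewrite !winf_nth ?sz ?ltn_predL //.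
by rewrite -sz nth_last; case: (w') sz d0 => //= _ <-.
Qed.

Lemma chain_step_lift1 : farey_lift p q (bcons true (winf w')) (winf w).
Proof.
have [p0 pq copr _ _] := reduced_slope km; have [? ?] := chain_step_ends.
by rewrite /w fareyE; apply: farey_lift_bullet.
Qed.

Lemma chain_step_size : size w = m.
Proof.
have [p0 pq copr _ mE] := reduced_slope km; have [? ?] := chain_step_ends.
by rewrite /w fareyE size_bullet // (chain_size F) mulnC -mE.
Qed.

(** The lift of the largest point of [w'], preceded by 0, belongs to the orbit of [w]
    and bounds it from above, so it is the largest point of that orbit. *)
Lemma chain_step_lift0 : farey_lift p q (bcons false (winf (Lmax w'))) (winf (Lmax w)).
Proof.
have [p0 pq copr _ mE] := reduced_slope km.
have [a0 al b0 bl] := chain_digits k'd F.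
have d0 : 0 < size w' by rewrite (chain_size F); lia.
have w0 : 0 < size w by rewrite chain_step_size; lia.
have L1 := chain_step_lift1; have per := chain_period F.
have [i Li] := farey_lift_max_shift p0 pq L1 per al (winf_Lmax_shift d0) bl.
rewrite (_ : winf (Lmax w) = iter i bshift (winf w)) //.
apply: winf_Lmax_unique => // [|j]; first by exists i.
apply: (farey_lift_orbit_max p0 pq copr L1 j _ Li) => n.
exact: winf_Lmax_ge.
Qed.

Lemma chain_facts_step : chain_facts m k w.
Proof.
have [p0 pq copr kE mE] := reduced_slope km.
have [a0 al b0 bl] := chain_digits k'd F.
have d0 : 0 < size w' by rewrite (chain_size F); lia.
have g0 : 0 < d by lia.
have L1 := chain_step_lift1; have per := chain_period F.
split; first exact: chain_step_size.
- have := farey_lift_smallest_period p0 pq copr L1 per al.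
  by rewrite mulnC -mE.
- move=> n; apply: (farey_lift_orbit_min p0 pq copr L1 n) => i.
  exact: chain_min F i.
have nk n : n * k = n * p * d by rewrite [in LHS]kE mulnA.
have mx x : m * x = q * x * d by rewrite [in LHS]mE mulnAC.
split=> n.
  by rewrite nk !mx !leq_pmul2r //; apply: farey_lift1_bounds L1 erefl.
move=> n0; rewrite nk !mx [in _ + m]mE -mulnDl !leq_pmul2r //.
exact: (farey_lift0_bounds p0 pq chain_step_lift0 erefl).
Qed.

End ChainStep.

Lemma chain_factsP m k ks : admissible m (k :: ks) ->
  chain_facts m k (chain_word m (k :: ks)).
Proof.
elim: ks m k => [|k' ks IH] m k /admissible_cons[km].
  by move/admissible_nil/eqP => copr; apply: chain_facts_base.
move=> adm; rewrite chain_word_cons; have /admissible_cons[k'd _] := adm.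
exact: chain_facts_step k'd (IH _ _ adm).
Qed.

(** * Monotonicity along the order on chains *)

Lemma vec_lt_cons x u y v :
  vec_lt (x :: u) (y :: v) <-> x < y \/ x = y /\ vec_lt u v.
Proof.
split=> [[[|n] [nuv pre lt]]|[lt|[-> [n [nuv pre lt]]]]].
- by left.
- right; split; first exact: (pre 0 isT).
  by exists n; split=> //= [|i ?]; [move: nuv; rewrite /= minnSS | exact: (pre i.+1)].
- by exists 0; split; rewrite /= ?minnSS.
- by exists n.+1; split=> //=; [rewrite minnSS | case=> //= i ?; exact: pre].
Qed.

Lemma chain_ltE m u v : chain_lt m u v <-> vec_lt u v.
Proof.
rewrite /chain_lt vec_lt_cons ltnn.
by split=> [[//|[]]|]; [ | right].
Qed.

Lemma vec_lt_nil u v : vec_lt u v -> u <> [::] /\ v <> [::].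
Proof. by case=> n [+ _ _]; case: u; case: v. Qed.

(** The line of slope [k' / m] lies strictly above that of slope [k / m], so an
    integer at most one below the former is at least any integer below the latter,
    and similarly for integers above the lines. At [2 * m] the lines are at
    least two apart, which exceeds the slack of one. *)
Lemma slope_bounds_lt m k k' a b a' b' : 0 < m -> k < k' ->
  slope_bounds m k a b -> slope_bounds m k' a' b' -> (a < a')%O /\ (b < b')%O.
Proof.
move=> m0 kk [Ba Bb] [Ba' Bb']; split; apply: (@psum_lt _ _ (2 * m)).
- move=> [|j] _; first by rewrite !psum0.
  have [_ h] := Ba j.+1; have [h' _] := Ba' j.+1.
  rewrite -ltnS -(ltn_pmul2l m0); apply: leq_ltn_trans h (leq_trans _ h').
  by rewrite ltn_pmul2l.
- have [_ h] := Ba (2 * m); have [h' _] := Ba' (2 * m); move: h h'.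
  by rewrite -!mulnA ![2 * (m * _)]mulnCA !leq_pmul2l //; lia.
- move=> [|j] _; first by rewrite !psum0.
  have [_ h] := Bb j.+1 isT; have [h' _] := Bb' j.+1 isT.
  rewrite -ltnS -(ltn_pmul2l m0) mulnS addnC.
  apply: leq_ltn_trans h _; rewrite ltn_add2r; apply: leq_trans h'.
  by rewrite ltn_pmul2l.
- have [|_ h] := Bb (2 * m); first by rewrite muln_gt0.
  have [|h' _] := Bb' (2 * m); first by rewrite muln_gt0.
  move: h h'; rewrite -!mulnA ![2 * (m * _)]mulnCA -[X in _ + X]muln1 -mulnDr.
  by rewrite !leq_pmul2l //; lia.
Qed.

Lemma bcons_lt c x y : (bcons c x < bcons c y)%O = (x < y)%O.
Proof. by rewrite bshift_lt. Qed.

(** Where the first entries differ their slopes decide; otherwise both words are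
    lifts along the same Farey word, and lifting is strictly increasing. *)
Lemma chain_mono m ks ks' : admissible m ks -> admissible m ks' -> vec_lt ks ks' ->
  (winf (chain_word m ks) < winf (chain_word m ks'))%O /\
  (bchain m ks < bchain m ks')%O.
Proof.
elim: ks m ks' => [|k ks IH] m [|k' ks'] adm adm' lt; try by case: (vec_lt_nil lt).
have [/admissible_cons[km adm2] /admissible_cons[k'm adm2']] := (adm, adm').
have [F F'] := (chain_factsP adm, chain_factsP adm').
move: lt; rewrite vec_lt_cons => -[kk|[e lt]].
  by apply: slope_bounds_lt kk (chain_slope F) (chain_slope F'); lia.
rewrite -{k'}e in k'm adm' adm2' F' *.
case: ks ks' IH {adm adm' F F'} adm2 adm2' lt => [|k1 ks] [|k1' ks'] IH adm adm' lt;
  try by case: (vec_lt_nil lt).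
have [lta ltb] := IH _ _ adm adm' lt.
have [p0 pq _ _ _] := reduced_slope km.
have [/admissible_cons[k1d _] /admissible_cons[k1d' _]] := (adm, adm').
have [G G'] := (chain_factsP adm, chain_factsP adm').
rewrite /bchain !chain_word_cons; split.
  apply: (farey_lift_lt p0 pq
    (chain_step_lift1 km k1d G) (chain_step_lift1 km k1d' G')) => //.
  by rewrite bcons_lt.
apply: (farey_lift_lt p0 pq
    (chain_step_lift0 km k1d G) (chain_step_lift0 km k1d' G')) => //.
by rewrite bcons_lt.
Qed.

(** No admissible chain is a proper prefix of another one: once the gcd is 1, no
    positive entry below it is left. *)
Lemma admissible_total m ks ks' : admissible m ks -> admissible m ks' ->
  [\/ ks = ks', vec_lt ks ks' | vec_lt ks' ks].
Proof.
elim: ks m ks' => [|k ks IH] m [|k' ks'].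
- by constructor 1.
- by move=> /admissible_nil -> /admissible_cons[]; case: k' => [|[]].
- by move=> /admissible_cons[km _] /admissible_nil e; move: km; rewrite e; case: k => [|[]].
move=> /admissible_cons[km adm] /admissible_cons[k'm adm'].
case: (ltngtP k k') => [lt|lt|e].
- by constructor 2; apply/vec_lt_cons; left.
- by constructor 3; apply/vec_lt_cons; left.
rewrite -e in adm' *; case: (IH _ _ adm adm') => [->|lt|lt]; first by constructor 1.
- by constructor 2; apply/vec_lt_cons; right.
- by constructor 3; apply/vec_lt_cons; right.
Qed.

Lemma bchain_lt m ks ks' : admissible m ks -> admissible m ks' ->
  (bchain m ks < bchain m ks')%O <-> vec_lt ks ks'.
Proof.
move=> adm adm'; split=> [lt|/(chain_mono adm adm')[] //].
case: (admissible_total adm adm') => // [e|/(chain_mono adm' adm)[_ gt]].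
  by rewrite e ltxx in lt.
by have := lt_trans lt gt; rewrite ltxx.
Qed.

Lemma bchain_le m ks ks' : admissible m ks -> admissible m ks' ->
  (bchain m ks <= bchain m ks')%O -> ks = ks' \/ vec_lt ks ks'.
Proof.
move=> adm adm' le; case: (admissible_total adm adm') => [||/(bchain_lt adm' adm)].
- by left.
- by right.
- by rewrite ltNge le.
Qed.

Lemma chain_word_le m ks ks' : admissible m ks -> admissible m ks' ->
  (bchain m ks <= bchain m ks')%O ->
  (winf (chain_word m ks) <= winf (chain_word m ks'))%O.
Proof.
move=> adm adm' /(bchain_le adm adm')[-> //|/(chain_mono adm adm')[/ltW //]].
Qed.

(** * Every orbit surrounds a chain *)

Lemma smallest_period_shift m x i :
  smallest_period m x -> smallest_period m (iter i bshift x).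
Proof.
move=> [m0 per min]; split=> //; first exact: periodic_shiftn.
move=> k km e; apply: (min k km).
have back y : iter m bshift y = y -> iter (i * m - i) bshift (iter i bshift y) = y.
  move=> pery; rewrite iter_bshiftD subnKC ?leq_pmulr //.
  by rewrite -[i * m]addn0 periodic_shift.
by rewrite -{2}(back x per) -e iter_bshiftD addnC -iter_bshiftD back // periodic_shiftn.
Qed.

Lemma const_shift1 x m c : iter m bshift x = x -> 0 < m ->
  (forall i, i < m -> x i = c) -> iter 1 bshift x = x.
Proof.
move=> per m0 xc; suff xE i : x i = c by apply/funext => i; rewrite /= /bshift !xE.
by rewrite (divn_eq i m) periodicE // xc // ltn_pmod.
Qed.

Lemma psum_all0 x m : psum x m = 0 -> forall i, i < m -> x i = false.
Proof.
elim: m => // m IH; rewrite psumS => /eqP; rewrite addn_eq0 => /andP[/eqP /IH h xm] i.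
by rewrite ltnS leq_eqVlt => /orP[/eqP ->|/h //]; case: (x m) xm.
Qed.

Lemma psum_all1 x m : m <= psum x m -> forall i, i < m -> x i = true.
Proof.
elim: m => // m IH; rewrite psumS => h i; have := psum_le x m => le.
have xm : x m = true by case: (x m) h => //; lia.
by rewrite ltnS leq_eqVlt => /orP[/eqP ->|] //; apply: IH; move: h; rewrite xm; lia.
Qed.

Lemma smallest_period_ones m x : 1 < m -> smallest_period m x -> 0 < psum x m < m.
Proof.
move=> m1 [m0 per min]; have {}min := min 1 m1.
apply/andP; split; rewrite ltnNge; apply/negP.
  by rewrite leqn0 => /eqP /psum_all0; move/(const_shift1 per m0).
by move/psum_all1/(const_shift1 per m0).
Qed.

Section Escape.
Variables (x : binseq) (m k : nat).
Hypothesis m0 : 0 < m.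

(** Take a drop by more than [m] of shortest length [n]. Neither of its two parts,
    when it is cut at [j], drops by more than [m]; so up to [j] the deviation
    is strictly negative, and a partial sum at most one below the line is at least
    as large. At [n] it is strictly larger. *)
Lemma escape_below i n : m * (psum (iter i bshift x) n).+1 < n * k ->
  exists j, forall a, (forall n, n * k <= m * (psum a n).+1) -> (iter j bshift x < a)%O.
Proof.
elim/ltn_ind: n i => n IH i lt.
have [[j [i' [jn lt']]]|no] :=
  EM (exists j i', j < n /\ m * (psum (iter i' bshift x) j).+1 < j * k).
  exact: IH jn _ lt'.
exists i => a Ba; apply: (@psum_lt _ _ n); last first.
  rewrite -ltnS -(ltn_pmul2l m0); exact: leq_trans lt (Ba n).
move=> j jn; case: (posnP j) => [->|j0]; first by rewrite !psum0.
rewrite -ltnS -(ltn_pmul2l m0); apply: leq_trans (Ba j).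
have h : (n - j) * k <= m * (psum (iter (i + j) bshift x) (n - j)).+1.
  rewrite leqNgt; apply/negP => lt'; apply: no; exists (n - j), (i + j).
  by split=> //; lia.
move: lt; rewrite -{1 2}(subnKC jn) psumD iter_bshiftD mulnDl -addnS mulnDr; lia.
Qed.

(** The mirror image of [escape_below]. *)
Lemma escape_above i n : n * k + m < m * psum (iter i bshift x) n ->
  exists j, forall b, (forall n, 0 < n -> m * psum b n <= n * k + m) ->
    (b < iter j bshift x)%O.
Proof.
elim/ltn_ind: n i => n IH i lt.
have [[j [i' [jn lt']]]|no] :=
  EM (exists j i', j < n /\ j * k + m < m * psum (iter i' bshift x) j).
  exact: IH jn _ lt'.
have n0 : 0 < n by case: n lt {IH no} => //; rewrite psum0; lia.
exists i => b Bb; apply: (@psum_lt _ _ n); last first.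
  rewrite -(ltn_pmul2l m0); exact: leq_ltn_trans (Bb n n0) lt.
move=> j jn; case: (posnP j) => [->|j0]; first by rewrite !psum0.
rewrite -ltnS -(ltn_pmul2l m0) mulnS; apply: leq_ltn_trans (Bb j j0) _.
have h : m * psum (iter (i + j) bshift x) (n - j) <= (n - j) * k + m.
  rewrite leqNgt; apply/negP => lt'; apply: no; exists (n - j), (i + j).
  by split=> //; lia.
move: lt; rewrite -{1 2}(subnKC jn) psumD iter_bshiftD mulnDl mulnDr; lia.
Qed.

Hypotheses (per : iter m bshift x = x) (ones : psum x m = k).

Lemma psum_period_shift i : psum (iter i bshift x) m = k.
Proof. by rewrite psum_shift addnC psumD per ones addnK. Qed.

(** Over [n] full periods the deviation returns to its initial value, so what is
    lost in the first [n] digits is regained in the others. *)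
Lemma below_above i n : m * (psum (iter i bshift x) n).+1 < n * k ->
  exists j l, l * k + m < m * psum (iter j bshift x) l.
Proof.
move=> lt; exists (i + n), (n * m - n).
have nm : n <= n * m by rewrite leq_pmulr.
have e : psum (iter i bshift x) (n * m) = n * k.
  by rewrite psumM ?periodic_shiftn // psum_period_shift.
have := psumD (iter i bshift x) n (n * m - n).
rewrite subnKC // e iter_bshiftD => e2.
have e3 : m * (n * k) = m * psum (iter i bshift x) n
    + m * psum (iter (i + n) bshift x) (n * m - n) by rewrite e2 mulnDr.
have : n * k <= n * m * k by rewrite leq_mul2r nm orbT.
by move: lt e3; rewrite mulnBl mulnCA -mulnA mulnS; lia.
Qed.

Lemma exists_top : exists i, forall n, m * psum (iter i bshift x) n <= n * k.
Proof.
(* The deviation at [i], shifted by [m * k] to make it a natural number. *)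
pose g (i : 'I_m) := m * psum x i + (m - i) * k.
case: (@arg_maxnP _ (Ordinal m0) xpredT g isT) => i0 _ max; exists i0 => n.
have r_lt := ltn_pmod (i0 + n) m0; set r := (i0 + n) %% m in r_lt.
have := max (Ordinal r_lt) isT; rewrite /g /=.
have E : psum x (i0 + n) = psum x i0 + psum (iter i0 bshift x) n by rewrite psumD.
have : psum x (i0 + n) = (i0 + n) %/ m * k + psum x r.
  rewrite {1}(divn_eq (i0 + n) m) psumD psumM // ones -[_ * m]addn0.
  by rewrite periodic_shift.
have := divn_eq (i0 + n) m; rewrite -/r; move: ((i0 + n) %/ m) => t iE e1.
rewrite e1 in E; rewrite !mulnBl.
have : i0 * k <= m * k by rewrite leq_mul2r ltnW ?orbT.
have : r * k <= m * k by rewrite leq_mul2r ltnW ?orbT.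
have : (i0 + n) * k = (t * m + r) * k by rewrite iE.
have : m * (t * k + psum x r) = m * (psum x i0 + psum (iter i0 bshift x) n) by rewrite E.
rewrite !mulnDr !mulnDl (mulnCA m t) -mulnA; lia.
Qed.

End Escape.

(** As long as the previous letter is 0, going back by one letter does not increase
    the sequence; by periodicity a letter 1 is met. *)
Lemma shift_back_true d (R c : binseq) i i0 : 0 < d -> iter d bshift R = R ->
  R i0 = true -> (iter i bshift R <= c)%O ->
  exists2 j, R j = true & (iter j.+1 bshift R <= c)%O.
Proof.
move=> d0 per Ri0; rewrite -(periodic_shift i i0.+1 per).
have -> : i0.+1 * d + i = i0.+1 + (i0.+1 * d - i0.+1 + i) by rewrite addnA subnKC ?leq_pmulr.
elim: (_ + i) => [|n IH] le; first by exists i0; rewrite // -(addn0 i0.+1).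
case E : (R (i0.+1 + n)); first by exists (i0.+1 + n); rewrite // -addnS.
apply: IH; rewrite addnS iterS in le; apply: le_trans le.
by apply: bshift_ge0; rewrite iter_bshiftE addn0.
Qed.

(** The mirror image of [shift_back_true]. *)
Lemma shift_back_false d (R c : binseq) i i0 : 0 < d -> iter d bshift R = R ->
  R i0 = false -> (c <= iter i bshift R)%O ->
  exists2 j, R j = false & (c <= iter j.+1 bshift R)%O.
Proof.
move=> d0 per Ri0; rewrite -(periodic_shift i i0.+1 per).
have -> : i0.+1 * d + i = i0.+1 + (i0.+1 * d - i0.+1 + i) by rewrite addnA subnKC ?leq_pmulr.
elim: (_ + i) => [|n IH] le; first by exists i0; rewrite // -(addn0 i0.+1).
case E : (R (i0.+1 + n)); last by exists (i0.+1 + n); rewrite // -addnS.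
apply: IH; rewrite addnS iterS in le; apply: (le_trans le).
by apply: bshift_le1; rewrite iter_bshiftE addn0.
Qed.

Section Top.
Variables (m k : nat) (y : binseq).
Hypothesis km : 0 < k < m.
Let d := gcdn m k.
Let p := k %/ d.
Let q := m %/ d.
Hypothesis top : forall n, m * psum y n <= n * k.
Hypothesis low : forall n, n * k <= m * (psum y n).+1.

(** The two values that the bounds allow at [j * q] are [j * p] and [j * p - 1]. *)
Definition block_letters : binseq := fun j => psum y (j * q) == j * p.

Let d0 : 0 < d. Proof. by rewrite gcdn_gt0; lia. Qed.

Let bounds n : n * p <= q * (psum y n).+1 /\ q * psum y n <= n * p.
Proof.
have [p0 pq copr kE mE] := reduced_slope km.
have nk i : i * k = i * p * d by rewrite [in LHS]kE mulnA.
have mx x : m * x = q * x * d by rewrite [in LHS]mE mulnAC.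
by have := low n; have := top n; rewrite !nk !mx !leq_pmul2r.
Qed.

Lemma block_letters0 : block_letters 0 = true.
Proof. by rewrite /block_letters psum0. Qed.

(** An integer in [[n * p / q - 1, n * p / q]] is the floor of [n * p / q], unless
    [q] divides [n]. *)
Lemma top_lift : farey_lift p q block_letters y.
Proof.
have [p0 pq copr kE mE] := reduced_slope km.
have q0 : 0 < q := leq_ltn_trans (leq0n p) pq.
move=> n; rewrite block_letters0 addn0; have [b1 b2] := bounds n.
have [/dvdnP[j nE]|qn] := boolP (q %| n).
  move: b1 b2; rewrite /block_letters nE mulnK // mulnAC mulnK // mulnC.
  rewrite -(mulnC q) !leq_pmul2l //; case: eqP => /=; lia.
rewrite addn0; apply/eqP; rewrite eqn_leq leq_divRL // [_ * q]mulnC b2 -ltnS ltn_divLR //.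
rewrite [_ * q]mulnC ltn_neqAle b1 andbT; apply: contra qn => /eqP e.
by rewrite -(Gauss_dvdl n (p := p)) 1?coprime_sym // e dvdn_mulr.
Qed.

Hypotheses (pery : smallest_period m y) (ones : psum y m = k).

Lemma block_letters_period : smallest_period d block_letters.
Proof.
have [p0 pq copr kE mE] := reduced_slope km; have [m0 per min] := pery.
have q0 : 0 < q := leq_ltn_trans (leq0n p) pq.
split=> //.
  apply/funext => j; rewrite iter_bshiftE /block_letters mulnDl -[d * q]mulnC -mE.
  by rewrite psumD per ones mulnDl -[d * p]mulnC -kE eqn_add2l.
move=> t /andP[t0 td] et; apply: (min (t * q)).
  by rewrite muln_gt0 t0 q0 /= [ltnRHS]mE mulnC ltn_pmul2l.
have := farey_lift_shift p0 pq t top_lift; rewrite et => L.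
by have [_ ->] := farey_lift_inj p0 pq L top_lift erefl.
Qed.

(** If [gcd(m, k) = 1], the exceptional places are the multiples of the period,
    where the partial sum is known. *)
Lemma top_farey n : d = 1 -> psum y n = n * k %/ m.
Proof.
move=> d1; have [_ per _] := pery; have m0 : 0 < m by lia.
have := top_lift n; rewrite block_letters0 /p /q d1 !divn1 addn0 => <-.
have [/dvdnP[j ->]|_] := boolP (m %| n); last by rewrite addn0.
by rewrite /block_letters /q /p d1 !divn1 mulnK // psumM // ones eqxx addn0.
Qed.

End Top.

(** The innermost spans are those of chains. The three cases are: a deviation
    that drops by more than [m]; a coprime number of digits 1, which forces a Farey
    word; and a lift of a sequence of smaller period. *)
Theorem chain_inside m x : 1 < m -> smallest_period m x ->
  exists ks, [/\ admissible m ks,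
    exists i, (iter i bshift x <= winf (chain_word m ks))%O &
    exists i, (bchain m ks <= iter i bshift x)%O].
Proof.
elim/ltn_ind: m x => m IH x m1 perx; have [m0 per _] := perx.
set k := psum x m; have km : 0 < k < m := smallest_period_ones m1 perx.
set d := gcdn m k.
have d0 : 0 < d by rewrite gcdn_gt0; lia.
have dm : d < m.
  have : d <= k by rewrite dvdn_leq ?dvdn_gcdr; lia.
  lia.
have [[i [n lt]]|bal] := EM (exists i n, m * (psum (iter i bshift x) n).+1 < n * k).
  (* In this case any chain that begins with [k] will do. *)
  have [ks adm] : exists ks, admissible m (k :: ks).
    have [d1|d1] := eqVneq d 1.
      by exists [::]; apply/admissible_cons; split=> //; apply/admissible_nil.
    exists [:: 1]; apply/admissible_cons; split=> //; apply/admissible_cons.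
    by rewrite -/d gcdn1; split; [lia | apply/admissible_nil].
  have [Ba Bb] := chain_slope (chain_factsP adm).
  exists (k :: ks); split=> //.
    have [j lta] := escape_below m0 lt.
    by exists j; apply/ltW/lta => l; have [] := Ba l.
  have [j [l lt']] := below_above m0 per erefl lt.
  have [j' ltb] := escape_above m0 lt'.
  by exists j'; apply/ltW/ltb => l' l0; have [] := Bb l' l0.
have [i top] := exists_top m0 per erefl.
set y := iter i bshift x in top.
have low n : n * k <= m * (psum y n).+1.
  by rewrite leqNgt; apply/negP => lt; apply: bal; exists i, n.
have pery : smallest_period m y := smallest_period_shift i perx.
have ones : psum y m = k by apply: psum_period_shift.
have [p0 pq copr kE mE] := reduced_slope km.
have [d1|d1] := eqVneq d 1.
  have adm : admissible m [:: k].
    by apply/admissible_cons; split=> //; apply/admissible_nil.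
  have e : winf (chain_word m [:: k]) = y.
    apply: psum_inj => n; rewrite chain_word1 fareyE -/d d1 !divn1.
    have [? ?] := andP km.
    by rewrite psum_farey // (top_farey km top low pery ones).
  exists [:: k]; split=> //; first by exists i; rewrite e.
  have w0 : 0 < size (chain_word m [:: k]) by rewrite (chain_size (chain_factsP adm)).
  have [j bE] := winf_Lmax_shift w0.
  by exists (i + j); rewrite /bchain bE e iter_bshiftD.
have d2 : 1 < d by lia.
set R := block_letters m k y.
have LR : farey_lift (k %/ d) (m %/ d) R y := top_lift km top low.
have perR : smallest_period d R := block_letters_period km top low pery ones.
have [ks [adm [j lea] [j' geb]]] := IH d dm R d2 perR.
have [_ eR minR] := perR.
have [i0 Ri0] : exists i0, R i0 = false.
  apply: contrapT => no; apply: (minR 1) => //.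
  apply: (@const_shift1 _ d true) => // l _; case E : (R l) => //.
  by case: no; exists l.
(* Lifts are compared only from equal letters: 1 at the smallest point of a chain,
   0 at the largest. So the points of [R] must be moved to such places. *)
have {lea} [j0 Rj0 lea] := shift_back_true d0 eR (block_letters0 m k y) lea.
have {geb} [j1 Rj1 geb] := shift_back_false d0 eR Ri0 geb.
have admk : admissible m (k :: ks) by apply/admissible_cons.
case: ks adm admk lea geb => [/admissible_nil|k' ks]; first by rewrite -/d; lia.
move=> adm admk lea geb; have G := chain_factsP adm.
have /admissible_cons[k'd _] := adm.
exists [:: k, k' & ks]; split=> //.
  exists (i + j0 * (m %/ d)); rewrite -iter_bshiftD chain_word_cons.
  apply: (farey_lift_le p0 pq (farey_lift_shift p0 pq j0 LR)
    (chain_step_lift1 km k'd G)); first by rewrite iter_bshiftE addn0.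
  by rewrite bshift_le // iter_bshiftE addn0.
exists (i + j1 * (m %/ d)); rewrite -iter_bshiftD /bchain chain_word_cons.
apply: (farey_lift_le p0 pq (chain_step_lift0 km k'd G)
  (farey_lift_shift p0 pq j1 LR)); first by rewrite iter_bshiftE addn0.
by rewrite bshift_le // iter_bshiftE addn0.
Qed.

(** * Enumeration of the admissible chains *)

(** The recursion is that of [psi_fuel], so [psi] counts the list. *)

Fixpoint chains_fuel (fuel n : nat) : seq (seq nat) :=
  if fuel is f.+1 then
    if n == 1 then [:: [::]]
    else [seq k :: ks | k <- index_iota 1 n, ks <- chains_fuel f (gcdn n k)]
  else [::].

Definition chains m := chains_fuel m m.

Lemma size_chains m : size (chains m) = psi m.
Proof.
rewrite /chains /psi; move: {1 3}m => f; elim: f m => //= f IH n.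
case: ifP => // _; rewrite size_allpairs_dep sumnE big_map.
by apply: eq_bigr => k _; rewrite IH.
Qed.

Lemma chains_uniq m : uniq (chains m).
Proof.
rewrite /chains; move: {1}m => f; elim: f m => //= f IH n.
case: ifP => // _; apply: allpairs_uniq_dep => [|k _|]; first exact: iota_uniq.
  exact: IH.
by move=> [k ks] [k' ks'] _ _ /= [-> ->].
Qed.

Lemma mem_chains m ks : 0 < m -> ks \in chains m <-> admissible m ks.
Proof.
rewrite /chains => m0; have : 0 < m <= m by rewrite m0 leqnn.
move: {3 4}m => f {m0}; elim: f m ks => [|f IH] m ks /andP[m0 mf].
  by rewrite leqNgt m0 in mf.
rewrite [chains_fuel _ _]/=; case: eqP => [->|/eqP m1].
  case: ks => [|k ks]; first by split=> // _; apply/admissible_nil.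
  by split=> // /admissible_cons[]; case: k => [|[]].
have IHk k ks' : 0 < k < m -> ks' \in chains_fuel f (gcdn m k) <-> admissible (gcdn m k) ks'.
  move=> /andP[k0 km]; apply: IH; rewrite gcdn_gt0 m0 /=.
  by have := dvdn_leq k0 (dvdn_gcdr m k); lia.
split.
  move=> /allpairsPdep[k [ks' [+ + ->]]]; rewrite mem_index_iota => km.
  by move/(IHk _ _ km) => adm; apply/admissible_cons.
case: ks => [/admissible_nil e|k ks /admissible_cons[km /IHk adm]].
  by rewrite e in m1.
apply/allpairsPdep; exists k, ks; split=> //; first by rewrite mem_index_iota.
exact: adm.
Qed.

(** * The values of [theta] *)

Lemma supremum_max (A : set binseq) c : A c -> (forall a, A a -> (a <= c)%O) ->
  supremum zeros A = c.
Proof.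
move=> Ac ub; have supA : supremums A c by split=> // y; apply.
rewrite /supremum ifF; last by apply/negbTE/set0P; exists c.
by apply: (is_subset1_supremums _ supA); case: xgetP => [y _ //|/(_ c)].
Qed.

Lemma max_below (T : eqType) (f : T -> binseq) (s : seq T) b :
  (forall t, t \in s -> (b < f t)%O) \/
  exists t, [/\ t \in s, (f t <= b)%O &
    forall t', t' \in s -> (f t' <= b)%O ->
      (f t' <= f t)%O].
Proof.
elim: s => [|t s IH]; first by left.
case: (ltP b (f t)) => [gt|le].
  case: IH => [no|[t0 [in0 le0 max]]].
    by left=> t'; rewrite inE => /orP[/eqP ->|/no].
  right; exists t0; split; rewrite ?inE ?in0 ?orbT // => t'.
  by rewrite inE => /orP[/eqP ->|/max //]; rewrite leNgt gt.
right; case: IH => [no|[t0 [in0 le0 max]]].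
  exists t; split; rewrite ?inE ?eqxx // => t'.
  by rewrite inE => /orP[/eqP -> //|/no]; rewrite ltNge => /negbTE ->.
case: (leP (f t0) (f t)) => c.
  exists t; split; rewrite ?inE ?eqxx // => t'.
  by rewrite inE => /orP[/eqP -> //|/max h /h /le_trans]; apply.
exists t0; split; rewrite ?inE ?in0 ?orbT // => t'.
by rewrite inE => /orP[/eqP -> _|/max //]; exact: ltW.
Qed.

Section Theta.
Variable m : nat.
Hypothesis m1 : 1 < m.

Lemma chain_facts_ex ks : admissible m ks ->
  exists2 k, 0 < k < m & chain_facts m k (chain_word m ks).
Proof.
case: ks => [/admissible_nil e|k ks adm]; first by move: m1; rewrite e.
by exists k; [case/admissible_cons: adm | exact: chain_factsP].
Qed.

(** The word of [ks] is itself a point of period [m] whose orbit lies between it and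
    [b]. Conversely an orbit between [a] and [b] spans some chain [ks'], so [a] is at
    most the word of [ks'], and [ks'] is at most [ks]. *)
Lemma theta_chain ks b : admissible m ks -> (bchain m ks <= b)%O ->
  (forall ks', admissible m ks' -> (bchain m ks' <= b)%O ->
    (bchain m ks' <= bchain m ks)%O) ->
  theta m b = winf (chain_word m ks).
Proof.
move=> adm le max; have [k km F] := chain_facts_ex adm.
have w0 : 0 < size (chain_word m ks) by rewrite (chain_size F); lia.
apply: supremum_max => [|a [x ax per]].
  exists (winf (chain_word m ks)); last exact: chain_period F.
  move=> n; split; first exact: chain_min F n.
  by apply: le_trans le; apply: winf_Lmax_ge.
have [ks' [adm' [i lei] [j lej]]] := chain_inside m1 per.
have [ai _] := ax i; have [_ jb] := ax j.
apply: le_trans ai (le_trans lei _).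
by apply: chain_word_le => //; apply: max => //; apply: le_trans jb.
Qed.

Lemma theta_zeros b : (forall ks, admissible m ks -> (b < bchain m ks)%O) ->
  theta m b = zeros.
Proof.
move=> no; rewrite /theta (_ : [set _ | _] = set0) ?supremum0 //.
apply/seteqP; split=> // a [x ax per].
have [ks [adm _ [j lej]]] := chain_inside m1 per.
have [_ jb] := ax j; have := le_trans lej jb.
by rewrite leNgt no.
Qed.

Lemma theta_cases b :
  (theta m b = zeros /\ forall ks, admissible m ks -> (b < bchain m ks)%O) \/
  exists ks, [/\ admissible m ks, (bchain m ks <= b)%O,
    forall ks', admissible m ks' -> (bchain m ks' <= b)%O ->
      (bchain m ks' <= bchain m ks)%O &
    theta m b = winf (chain_word m ks)].
Proof.
have mem ks : ks \in chains m <-> admissible m ks by apply: mem_chains; lia.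
case: (max_below (bchain m) (chains m) b) => [no|[ks [/mem adm le max]]].
  have no' ks : admissible m ks -> (b < bchain m ks)%O by move=> /mem/no.
  by left; split=> //; exact: theta_zeros.
have max' ks' : admissible m ks' -> (bchain m ks' <= b)%O ->
  (bchain m ks' <= bchain m ks)%O by move=> /mem; exact: max.
by right; exists ks; split=> //; exact: theta_chain.
Qed.

Lemma theta_congr b z :
  (forall ks, admissible m ks -> (bchain m ks <= z)%O = (bchain m ks <= b)%O) ->
  theta m z = theta m b.
Proof.
move=> e; case: (theta_cases b) => [[-> no]|[ks [adm le max ->]]].
  by apply: theta_zeros => ks adm; rewrite ltNge e // -ltNge no.
by apply: theta_chain => [//||ks' adm']; rewrite e //; exact: max.
Qed.

(** * Discontinuities *)

Lemma nbhs_cylinder (b : binseq) N : \forall z \near b, forall i, i < N -> z i = b i.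
Proof.
elim: N => [|N IH]; first exact: (@filterE _ (nbhs b)).
have dig : \forall z \near b, z N = b N.
  exact: (@proj_continuous nat (fun=> bool) N b _ (discrete_set1 (b N))).
near=> z => i; rewrite ltnS leq_eqVlt => /orP[/eqP ->|].
  by near: z; exact: dig.
by move: i; near: z; exact: IH.
Unshelve. all: by end_near.
Qed.

Lemma near_le_const (c b : binseq) : c <> b ->
  \forall z \near b, (c <= z)%O = (c <= b)%O.
Proof.
move=> ne; case: (ltgtP c b) => // lt; have /lt_binseqP[n [pre e0 e1]] := lt.
  near=> z; apply/ltW/lt_binseqP; exists n.
  have zb : forall i, i < n.+1 -> z i = b i by near: z; exact: nbhs_cylinder.
  by split=> // [i ni|]; rewrite zb ?pre //; apply: ltnW.
near=> z; apply/negbTE; rewrite -ltNge; apply/lt_binseqP; exists n.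
have zb : forall i, i < n.+1 -> z i = b i by near: z; exact: nbhs_cylinder.
by split=> // [i ni|]; [rewrite zb ?pre //; exact: ltnW | rewrite zb].
Unshelve. all: by end_near.
Qed.

(** Only finitely many points [bchain] exist, so near any other point the set of
    those below does not change. *)
Lemma theta_continuous b : (forall ks, admissible m ks -> bchain m ks <> b) ->
  {for b, continuous (theta m)}.
Proof.
move=> ne; apply: cvg_near_cst.
have mem ks : ks \in chains m <-> admissible m ks by apply: mem_chains; lia.
have {}ne ks : ks \in chains m -> bchain m ks <> b by move/mem/ne.
have H : \forall z \near b, forall ks, ks \in chains m ->
    (bchain m ks <= z)%O = (bchain m ks <= b)%O.
  elim: (chains m) ne => [|ks s IH] ne; first exact: (@filterE _ (nbhs b)).
  have ne1 : bchain m ks <> b by apply: ne; rewrite inE eqxx.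
  have {}IH : \forall z \near b, forall ks', ks' \in s ->
      (bchain m ks' <= z)%O = (bchain m ks' <= b)%O.
    by apply: IH => ks' ks's; apply: ne; rewrite inE ks's orbT.
  near=> z => ks'; rewrite inE => /orP[/eqP ->|].
    by near: z; exact: near_le_const.
  by move: ks'; near: z.
near=> z; apply: theta_congr => ks /mem.
by move: ks; near: z.
Unshelve. all: by end_near.
Qed.

(** The truncations approach [b] from below. *)
Definition truncation (b : binseq) N : binseq := fun i => if i < N then b i else false.

Lemma truncation_cvg b : truncation b @ \oo --> b.
Proof.
apply/cvg_sup => N U [V] [[W] oW <-] WfN WU.
by apply: (filterS WU); rewrite nbhs_simpl /truncation; exists N.+1 => // i /= ->.
Qed.

Lemma truncation_lt (b : binseq) N : (exists2 i, N <= i & b i) -> (truncation b N < b)%O.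
Proof.
move=> [i Ni bi]; apply: (@psum_lt _ _ i.+1) => [j _|]; last first.
  have ti : truncation b N i = false by rewrite /truncation ltnNge Ni.
  rewrite !psumS bi ti addn0 addn1 ltnS.
  by apply: leq_sum => l _; rewrite /truncation; case: ifP.
by apply: leq_sum => l _; rewrite /truncation; case: ifP.
Qed.

(** Below [bchain m ks] the values of [theta m] are [zeros] or words of other chains.
    They have period [m], hence differ from the value at [bchain m ks] within
    the first [m] digits and cannot converge to it. *)
Lemma theta_discontinuous ks : admissible m ks ->
  ~ {for bchain m ks, continuous (theta m)}.
Proof.
move=> adm cont; set b := bchain m ks in cont.
have [k km F] := chain_facts_ex adm.
have [a0 al b0 bl] := chain_digits km F.
have [m0 pera _] := chain_period F.
have thb : theta m b = winf (chain_word m ks) by apply: theta_chain.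
have perb : iter m bshift b = b.
  by rewrite /b /bchain -{1}(chain_size F) -size_Lmax winf_periodic.
have [N thN] : exists N, forall i, i < m -> theta m (truncation b N) i = theta m b i.
  have := cvg_comp _ _ (@truncation_cvg b) cont.
  move/(_ _ (nbhs_cylinder (theta m b) m)) => [N _ h]; exists N.
  by apply: h => /=.
have lt : (truncation b N < b)%O.
  apply: truncation_lt; exists (N * m); first by rewrite leq_pmulr.
  by rewrite -[N * m]addn0 periodicE // /b /bchain b0.
case: (theta_cases (truncation b N)) => [[th _]|[ks' [adm' le _ th]]].
  by have := thN m.-1; rewrite th thb al ltn_predL m0 => /(_ isT).
have [k' _ F'] := chain_facts_ex adm'; have [_ pera' _] := chain_period F'.
have e : winf (chain_word m ks') = winf (chain_word m ks).
  apply/funext => i; rewrite (divn_eq i m) !periodicE //.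
  by have := thN (i %% m); rewrite th thb ltn_pmod // => /(_ isT).
have /(bchain_lt adm' adm)/(chain_mono adm' adm)[] := le_lt_trans le lt.
by rewrite e ltxx.
Qed.

Lemma discontinuities_theta :
  discontinuities (theta m) = [set bchain m ks | ks in admissible m].
Proof.
apply/seteqP; split=> [b disc|_ [ks adm <-]]; last exact: theta_discontinuous.
apply: contrapT => no; apply: disc; apply: theta_continuous => ks adm e.
by apply: no; exists ks.
Qed.

Lemma card_bchain : [set bchain m ks | ks in admissible m] #= `I_(psi m).
Proof.
have inj : {in (admissible m : set (seq nat)) &, injective (bchain m)}.
  move=> ks ks'; rewrite !inE => adm adm' e.
  case: (bchain_le adm adm'); rewrite ?e // => /(bchain_lt adm adm').
  by rewrite e ltxx.
rewrite (card_eql (inj_card_eq inj)).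
rewrite (_ : admissible m = [set` [fset ks in chains m]%fset]).
  by apply/card_eq_fsetP; rewrite card_fseq undup_id ?chains_uniq ?size_chains.
apply/seteqP; split=> ks /=; rewrite inE => h; apply/mem_chains => //; lia.
Qed.

End Theta.

Theorem theorem1p6 (m : nat) (hm : 2 <= m) :
  [/\ discontinuities (theta m) = [set bchain m ks | ks in admissible m] /\
      (discontinuities (theta m) #= `I_(psi m)),
      forall ks ks' : seq nat, admissible m ks -> admissible m ks' ->
        ((bchain m ks < bchain m ks')%O <-> chain_lt m ks ks'),
      forall b : binseq, (b < bchain m [:: 1])%O -> theta m b = zeros,
      forall b : binseq, (bchain m [:: m - 1] <= b)%O ->
        theta m b = winf (farey (m - 1) m) &
      forall (ks : seq nat) (b : binseq), admissible m ks -> ks <> [:: m - 1] ->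
        partition_interval m ks b -> theta m b = winf (chain_word m ks)].
Proof.
have adm1 : admissible m [:: 1].
  by apply/admissible_cons; rewrite gcdn1; split=> //; apply/admissible_nil.
have admm : admissible m [:: m - 1].
  apply/admissible_cons; split; first lia.
  by apply/admissible_nil/eqP; rewrite subn1; apply: coprimenP; lia.
split.
- by rewrite discontinuities_theta //; split=> //; exact: card_bchain.
- by move=> ks ks' adm adm'; rewrite chain_ltE; exact: bchain_lt.
- move=> b lt; apply: theta_zeros => // ks adm; apply: lt_le_trans lt _.
  rewrite leNgt; apply/negP => /(bchain_lt adm adm1).
  case: ks adm => [_ /vec_lt_nil[] //|k ks /admissible_cons[km _] /vec_lt_cons[|[_]]].
    by lia.
  by move/vec_lt_nil => [].
- move=> b le; rewrite -chain_word1; apply: theta_chain => // ks adm _.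
  rewrite leNgt; apply/negP => /(bchain_lt admm adm).
  case: ks adm => [_ /vec_lt_nil[] //|k ks /admissible_cons[km _] /vec_lt_cons[|[_]]].
    by lia.
  by move/vec_lt_nil => [].
move=> ks b adm _ [ks' [[adm' /chain_ltE lt succ] le gt]].
apply: theta_chain => // ls adml leb; rewrite leNgt; apply/negP => lt'.
apply: (succ ls adml); split; apply/chain_ltE; first exact/(bchain_lt adm adml).
by apply/(bchain_lt adml adm'); exact: le_lt_trans leb gt.
Qed.
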